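(* For every $\gamma>0$ and every $r\in\mathbb{N}$ there exist constants $c,c'>0$ such that, for every function $p=p(n)$ with $n^{-1/2}/c'\le p(n)\le c'$, the random graph $\Gamma=G(n,p)$ asymptotically almost surely has a triangle-free spanning subgraph $H$ with minimum degree $\delta(H)\ge\left(\frac12-\gamma\right)pn$ which cannot be made $r$-partite by removing fewer than $cp^{-1}n$ edges.
   Context: $G(n,p)$ is the binomial random graph on vertex set $[n]=\{1,\dots,n\}$, in which each pair of vertices is an edge independently with probability $p$. ''Asymptotically almost surely'' means with probability tending to $1$ as $n\to\infty$. A spanning subgraph of $\Gamma$ is a subgraph with the same vertex set as $\Gamma$. A graph is $r$-partite if it is properly $r$-colourable. $\mathbb{N}$ denotes the positive integers. *)

(* Defs.v *)
From HB Require Import structures.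
From mathcomp Require Import all_boot all_order all_algebra.
From mathcomp Require Import all_classical all_reals all_analysis.

Set Implicit Arguments.
Unset Strict Implicit.
Unset Printing Implicit Defensive.

Import Order.TTheory GRing.Theory Num.Theory.
Import numFieldNormedType.Exports.

Local Open Scope ring_scope.

Definition pairs (V : finType) : {set {set V}} := [set e : {set V} | #|e| == 2%N].

Record sgraph (V : finType) := SGraph {
  edges : {set {set V}};
  edgesP : edges \subset pairs V }.

HB.instance Definition _ (V : finType) := [isSub for @edges V].
HB.instance Definition _ (V : finType) := [Finite of sgraph V by <:].

Section Graphs.
Variable V : finType.
Implicit Types G H : sgraph V.

(* [adj G x x] is false: [[set x; x]] is a singleton, hence not in [pairs V]. *)
Definition adj G (x y : V) : bool := [set x; y] \in edges G.

Definition degree G (x : V) : nat := #|[set y | adj G x y]|.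

(* Every degree is less than [#|V|], so the default value of the minimum plays
   no role unless [V] is empty. *)
Definition min_degree G : nat := \big[minn/#|V|]_(x : V) degree G x.

Definition spanning_subgraph H G : bool := edges H \subset edges G.

(* Adjacency is irreflexive, so the three vertices below are distinct. *)
Definition triangle_free G : bool :=
  ~~ [exists x, exists y, exists z, [&& adj G x y, adj G y z & adj G x z]].

Definition partite (r : nat) G : bool :=
  [exists f : {ffun V -> 'I_r},
    [forall x, forall y, adj G x y ==> (f x != f y)]].

Definition del_edges G (D : {set {set V}}) : sgraph V :=
  SGraph (fintype.subset_trans (subsetDl (edges G) D) (edgesP G)).

End Graphs.

Section RandomGraph.
Variables (R : realType) (n : nat) (p : R).

Definition gnp_mass (G : sgraph 'I_n) : R :=
  \prod_(e in pairs 'I_n) (if e \in edges G then p else 1 - p).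

Definition gnp_prob (A : pred (sgraph 'I_n)) : R :=
  \sum_(G : sgraph 'I_n | A G) gnp_mass G.

(* With [S = set0], the total mass is 1; in general, the edges are mutually
   independent, each present with probability [p]. *)
Lemma gnp_prob_subset (S : {set {set 'I_n}}) : S \subset pairs 'I_n ->
  gnp_prob (fun G => S \subset edges G) = p ^+ #|S|.
Proof.
move=> SP; rewrite /gnp_prob /gnp_mass.
pose F (e : {set 'I_n}) : R := if e \in pairs 'I_n then p else 0.
pose F' (e : {set 'I_n}) : R :=
  if e \in pairs 'I_n then if e \in S then 0 else 1 - p else 1.
have -> : p ^+ #|S| = \prod_e (F e + F' e).
  rewrite -prodr_const [LHS]big_mkcond /=; apply: eq_bigr => e _; rewrite /F /F'.
  have [eS|eS] := boolP (e \in S); first by rewrite (fintype.subsetP SP) // addr0.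
  by case: ifP => _; rewrite ?add0r // addrC subrK.
rewrite bigA_distr.
rewrite [RHS](bigID (fun J : {set {set 'I_n}} => (S \subset J) && (J \subset pairs 'I_n))) /=.
rewrite [X in _ = _ + X]big1 ?addr0; last first.
  move=> J; rewrite negb_and => /orP[] /subsetPn[e e1 e2];
    rewrite (bigD1 e) //= /F /F'.
    by rewrite (negbTE e2) (fintype.subsetP SP) // e1 mul0r.
  by rewrite e1 (negbTE e2) mul0r.
rewrite [RHS](reindex_omap (@edges 'I_n) insub) /=; last first.
  by move=> J /andP[_ JP]; rewrite insubT.
apply: eq_big => [G|G SG].
  by rewrite edgesP valK eqxx !andbT.
rewrite big_mkcond /=; apply: eq_bigr => e _; rewrite /F /F'.
have [eP|eP] := boolP (e \in pairs _).
  case: ifPn => // eG; case: ifPn => // eS.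
  by rewrite (fintype.subsetP SG) in eG.
by case: ifPn => // /(fintype.subsetP (edgesP G)); rewrite (negbTE eP).
Qed.

End RandomGraph.

(* Main.v *)
Require Import Defs.
From HB Require Import structures.
From mathcomp Require Import all_boot all_order all_algebra.
From mathcomp Require Import all_classical all_reals all_analysis.
From mathcomp Require Import zify ring lra.
Import Order.TTheory GRing.Theory Num.Theory.
Import numFieldNormedType.Exports.
Set Implicit Arguments.
Unset Strict Implicit.
Unset Printing Implicit Defensive.
Local Open Scope ring_scope.

(* Split the vertices into halves A and B.  Fix a triangle-free template T on t
   vertices that is not r-colourable (a shift graph), cut A into blocks of
   t m vertices with m ~ kappa / p^2, and let K be the union over the blocks of
   the blow-ups of T with classes of size m; K is triangle-free with maximum
   degree at most t m.  Let F be the part of Gamma in K that avoids the few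
   vertices whose degree there is much larger than its mean p t m ~ kappa / p,
   and let H consist of F and the edges of Gamma between A and B, except those
   edges xy, x in A, y in B, such that y is adjacent to an F-neighbour of x.
   Then H is triangle-free.

   Every vertex keeps its cross degree up to O(kappa p n): the deleted edges at
   x are those from x to a set of size O(kappa n) determined by edges of Gamma
   other than the ones being counted, so Chernoff's bound applies conditionally.

   Every r-colouring of A makes, in each block, at least (m/r)^2 pairs of K
   monochromatic, hence Omega(n m) pairs overall, also off any small set U of
   discarded vertices.  By Chernoff and a union bound over all (2r)^n choices of
   the colouring and of U, Omega(p n m) = Omega(n / p) of them are edges of F. *)

(** * Binomial random subsets of a finite set *)

Section RandomSubset.
Variables (R : realType) (I : finType) (P : {set I}) (p : R).
Hypothesis p01 : 0 <= p <= 1.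
Implicit Types (J W : {set I}) (h : {set I} -> R).

Definition rs_mass J : R := \prod_(i in P) (if i \in J then p else 1 - p).

Definition rs_exp h : R := \sum_(J : {set I} | J \subset P) rs_mass J * h J.

Lemma rs_mass_ge0 J : 0 <= rs_mass J.
Proof.
by apply: prodr_ge0 => i _; case/andP: p01 => p0 p1; case: ifP => // _; rewrite subr_ge0.
Qed.

Lemma rs_exp_le h1 h2 :
  (forall J, J \subset P -> h1 J <= h2 J) -> rs_exp h1 <= rs_exp h2.
Proof. by move=> le12; apply: ler_sum => J JP; rewrite ler_wpM2l ?rs_mass_ge0 ?le12. Qed.

Lemma eq_rs_exp h1 h2 :
  (forall J, J \subset P -> h1 J = h2 J) -> rs_exp h1 = rs_exp h2.
Proof. by move=> eq12; apply: eq_bigr => J JP; rewrite eq12. Qed.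

Lemma rs_expZ a h : rs_exp (fun J => a * h J) = a * rs_exp h.
Proof. by rewrite /rs_exp mulr_sumr; apply: eq_bigr => J _; rewrite mulrCA. Qed.

Lemma rs_exp_sum (T : finType) (Q : pred T) (h : T -> {set I} -> R) :
  rs_exp (fun J => \sum_(k | Q k) h k J) = \sum_(k | Q k) rs_exp (h k).
Proof.
by rewrite /rs_exp exchange_big /=; apply: eq_bigr => J _; rewrite mulr_sumr.
Qed.

Lemma rs_expB h1 h2 : rs_exp (fun J => h1 J - h2 J) = rs_exp h1 - rs_exp h2.
Proof. by rewrite /rs_exp -sumrB; apply: eq_bigr => J _; rewrite mulrBr. Qed.

Lemma rs_expD h1 h2 : rs_exp (fun J => h1 J + h2 J) = rs_exp h1 + rs_exp h2.
Proof. by rewrite /rs_exp -big_split; apply: eq_bigr => J _; rewrite mulrDr. Qed.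

(** The coordinate [i] may be redrawn by a fresh coin: sets pair up as [J] and [i |: J] with [i] not
    in [J], and their masses share the factor [m J]. *)
Lemma rs_exp_resample (i : I) h : i \in P ->
  rs_exp h = rs_exp (fun J => p * h (i |: J) + (1 - p) * h (J :\ i)).
Proof.
move=> iP.
pose m J := \prod_(j in P | j != i) (if j \in J then p else 1 - p).
have mE J : rs_mass J = (if i \in J then p else 1 - p) * m J.
  by rewrite /rs_mass (bigD1 i).
have mU J : m (i |: J) = m J.
  by apply: eq_bigr => j /andP[_ ji]; rewrite in_setU1 (negbTE ji).
have split_i (h' : {set I} -> R) : rs_exp h' =
    \sum_(J : {set I} | (J \subset P) && (i \notin J))
      m J * (p * h' (i |: J) + (1 - p) * h' J).
  rewrite /rs_exp (bigID (fun J : {set I} => i \notin J)) /= addrC.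
  rewrite (reindex_onto (fun J => i |: J) (fun J => J :\ i)) /=; last first.
    by move=> J /andP[_]; rewrite negbK => iJ; rewrite finset.setD1K.
  rewrite (eq_bigl (fun J : {set I} => (J \subset P) && (i \notin J))); last first.
    move=> J; rewrite finset.subUset finset.sub1set iP /= finset.setU11 /=.
    have [iJ|iJ] := boolP (i \in J); last by rewrite finset.setU1K // eqxx !andbT.
    rewrite !andbF; apply/negP => /andP[_ /eqP JE].
    by move: iJ; rewrite -JE !inE eqxx.
  rewrite -big_split /=; apply: eq_bigr => J /andP[JP iJ].
  rewrite !mE mU finset.setU11 (negbTE iJ); ring.
rewrite (split_i h) split_i; apply: eq_bigr => J /andP[_ iJ].
rewrite finset.setUA finset.setUid finset.setU1K //.
have -> : J :\ i = J.
  by apply/setP => j; rewrite !inE; case: eqVneq => // ->; rewrite (negbTE iJ).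
ring.
Qed.

(** Since [h] does not see the coordinates in [s], redrawing them one at a time pulls out a factor
    [p * z + (1 - p)] for each. *)
Lemma rs_exp_prod (z : R) (h : {set I} -> R) (s : seq I) :
  uniq s -> {subset s <= P} ->
  (forall i J, i \in s -> h (i |: J) = h (J :\ i)) ->
  rs_exp (fun J => h J * \prod_(i <- s) (if i \in J then z else 1)) =
    (1 + p * (z - 1)) ^+ size s * rs_exp h.
Proof.
elim: s => [|i s IHs] /= => [_ _ _|/andP[iNs us] sP hs].
  by rewrite mul1r; apply: eq_rs_exp => J _; rewrite big_nil mulr1.
rewrite exprS -mulrA -IHs //; first last.
- by move=> j J js; apply: hs; rewrite inE js orbT.
- by move=> j js; apply: sP; rewrite inE js orbT.
pose h' J := h J * \prod_(j <- s) (if j \in J then z else 1).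
have prodU J : \prod_(j <- s) (if j \in i |: J then z else 1) =
               \prod_(j <- s) (if j \in J then z else 1).
  apply: eq_big_seq => j js; rewrite in_setU1.
  by have [ji|//] := eqVneq j i; rewrite -ji js in iNs.
have prodD J : \prod_(j <- s) (if j \in J :\ i then z else 1) =
               \prod_(j <- s) (if j \in J then z else 1).
  apply: eq_big_seq => j js; rewrite in_setD1.
  by have [ji|//] := eqVneq j i; rewrite -ji js in iNs.
have iP : i \in P by apply: sP; rewrite mem_head.
rewrite (rs_exp_resample _ iP) -rs_expZ [RHS](rs_exp_resample _ iP).
apply: eq_rs_exp => J _.
rewrite !big_cons !prodU !prodD !inE eqxx /= (hs i J) ?mem_head //; ring.
Qed.

Lemma rs_exp1 : rs_exp (fun=> 1) = 1.
Proof.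
rewrite /rs_exp /rs_mass.
under eq_bigr => J JP.
  rewrite mulr1 big_mkcond /=.
  (* Coordinates outside [P] get weights 0 and 1, so the product of the sums expands over all sets
     and those not contained in [P] contribute 0. *)
  have -> : \prod_i (if i \in P then if i \in J then p else 1 - p else 1) =
    \prod_i (if i \in J then (if i \in P then p else 0) else
                             (if i \in P then 1 - p else 1)).
    apply: eq_bigr => i _; case: ifPn => iP //.
    by case: ifP => // /(fintype.subsetP JP); rewrite (negbTE iP).
  over.
transitivity (\prod_(i : I) ((if i \in P then p else 0) + (if i \in P then 1 - p else 1))); last first.
  by rewrite big1 // => i _; case: ifP => _; rewrite ?add0r // addrC subrK.
rewrite [X in _ = X]bigA_distr [X in _ = X](bigID (fun J : {set I} => J \subset P)) /=.
rewrite [X in _ = _ + X]big1 ?addr0 // => J /subsetPn[i iJ iP].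
by rewrite (bigD1 i) //= iJ (negbTE iP) mul0r.
Qed.

Lemma rs_exp_ge0 h : (forall J, 0 <= h J) -> 0 <= rs_exp h.
Proof. by move=> h0; apply: sumr_ge0 => J _; rewrite mulr_ge0 ?rs_mass_ge0. Qed.

Lemma prod_indic_expR (a : R) W J :
  \prod_(i <- enum W) (if i \in J then expR a else 1) =
  expR (a * #|J :&: W|%:R).
Proof.
rewrite big_enum /= -big_mkcondr /= prodr_const [a * _]mulrC expRM_natl.
by congr (_ ^+ _); apply: eq_card => i; rewrite !inE andbC.
Qed.

(** Each coordinate of [W] contributes [1 + p * (expR a - 1)], which is at most
    [expR (p * (expR a - 1))]. The weight [h] later carries the conditioning. *)
Lemma rs_mgf_le (a : R) (h : {set I} -> R) W : W \subset P ->
  (forall J, 0 <= h J) ->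
  (forall i J, i \in W -> h (i |: J) = h (J :\ i)) ->
  rs_exp (fun J => h J * expR (a * #|J :&: W|%:R)) <=
    expR (p * (expR a - 1) * #|W|%:R) * rs_exp h.
Proof.
move=> WP h0 hW.
have -> : rs_exp (fun J => h J * expR (a * #|J :&: W|%:R)) =
  rs_exp (fun J => h J * \prod_(i <- enum W) (if i \in J then expR a else 1)).
  by apply: eq_rs_exp => J _; rewrite prod_indic_expR.
rewrite rs_exp_prod ?enum_uniq //; first last.
- by move=> i J; rewrite mem_enum; apply: hW.
- by move=> i; rewrite mem_enum => /(fintype.subsetP WP).
rewrite ler_wpM2r ?rs_exp_ge0 // -cardE [_ * #|W|%:R]mulrC expRM_natl lerXn2r ?nnegrE ?expR_ge0 //.
- case/andP: p01 => p0 p1; have := expR_ge0 a; nra.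
- exact: expR_ge1Dx.
Qed.

(* The random set [W J] must not depend on the coordinates in [S], so that
   conditionally on them [J :&: W J] is still binomial. *)
Lemma rs_upper_tail (W : {set I} -> {set I}) (S : {set I}) (s L : R) :
  S \subset P -> (forall J, W J \subset S) ->
  (forall i J, i \in S -> W (i |: J) = W (J :\ i)) ->
  4 * p * s <= L ->
  rs_exp (fun J => ((#|W J|%:R <= s) && (L <= #|J :&: W J|%:R))%:R)
    <= expR (- (L / 4)).
Proof.
move=> SP WS Winv sL; case/andP: (p01) => p0 p1.
(* With this exponent [expR a - 1 <= 1], so the final exponent is at most [p * s - L / 2], and
   [p * s <= L / 4]. *)
pose a : R := 1 / 2.
have ea : expR a - 1 <= 1.
  have h : expR a * expR (- a) = 1 by rewrite -expRD subrr expR0.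
  have : 1 + - a <= expR (- a) by exact: expR_ge1Dx.
  have := expR_ge0 a; rewrite /a in h * => ??; nra.
have ea0 : 0 <= expR a - 1.
  have : 1 + a <= expR a by exact: expR_ge1Dx.
  by rewrite /a; lra.
(* Condition on the value [w] of [W J]: the indicator [ind w] ignores the coordinates in [w],
   because they lie in [S]. *)
pose ind (w : {set I}) J : R := (W J == w)%:R.
pose small (w : {set I}) := (w \subset S) && (#|w|%:R <= s).
have bound w : small w ->
    rs_exp (fun J => ind w J * expR (a * #|J :&: w|%:R)) <=
      expR (p * s) * rs_exp (ind w).
  move=> /andP[wS ws].
  apply: le_trans (rs_mgf_le a (fintype.subset_trans wS SP) _ _) _ => //.
  - by move=> i J iw; rewrite /ind Winv // (fintype.subsetP wS).
  rewrite ler_wpM2r //; first by apply: rs_exp_ge0 => J; rewrite ler0n.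
  rewrite ler_expR -mulrA ler_wpM2l //.
  apply: le_trans (_ : 1 * #|w|%:R <= _); last by rewrite mul1r.
  by rewrite ler_wpM2r.
have total : \sum_(w : {set I} | small w) rs_exp (ind w) <= 1.
  rewrite -rs_exp_sum -rs_exp1; apply: rs_exp_le => J _.
  have [sJ|sJ] := boolP (small (W J)).
    rewrite (bigD1 (W J)) //= big1 ?addr0 /ind ?eqxx // => w /andP[_ wN].
    by rewrite eq_sym (negbTE wN).
  rewrite big1 // => w sw; rewrite /ind; case: eqP => // wE.
  by rewrite wE sw in sJ.
(* Markov's inequality in exponential form, split according to the value of [W J]. *)
apply: (@le_trans _ _ (rs_exp (fun J => expR (- (a * L)) *
    \sum_(w : {set I} | small w) ind w J * expR (a * #|J :&: w|%:R)))).
  apply: rs_exp_le => J _.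
  have sum0 : 0 <= \sum_(w : {set I} | small w) ind w J * expR (a * #|J :&: w|%:R).
    by apply: sumr_ge0 => w _; rewrite mulr_ge0 ?ler0n ?expR_ge0.
  case: andP => [[h1 h2]|_] /=; last by rewrite mulr_ge0 ?expR_ge0.
  rewrite (bigD1 (W J)) /= ?/small ?WS //.
  rewrite /ind eqxx mul1r mulrDr -expRD.
  apply: le_trans (_ : expR (- (a * L) + a * #|J :&: W J|%:R) <= _).
    apply: le_trans (expR_ge1Dx _).
    by rewrite lerDl -mulrN -mulrDr mulr_ge0 // /a; lra.
  rewrite lerDl mulr_ge0 ?expR_ge0 //.
  by apply: sumr_ge0 => w _; rewrite mulr_ge0 ?ler0n ?expR_ge0.
rewrite rs_expZ rs_exp_sum.
apply: (@le_trans _ _ (expR (- (a * L)) * (expR (p * s) * 1))).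
  rewrite ler_wpM2l ?expR_ge0 //.
  apply: le_trans (_ : \sum_(w : {set I} | small w) expR (p * s) * rs_exp (ind w) <= _).
    exact: ler_sum.
  by rewrite -mulr_sumr ler_wpM2l ?expR_ge0.
by rewrite mulr1 -expRD ler_expR /a; lra.
Qed.

Lemma rs_lower_tail (W : {set I}) (eta : R) : W \subset P -> 0 <= eta ->
  rs_exp (fun J => (#|J :&: W|%:R < (1 - eta) * (p * #|W|%:R))%R%:R)
    <= expR (- (eta ^+ 2 * (p * #|W|%:R) / 4)).
Proof.
move=> WP eta0; case/andP: (p01) => p0 p1.
(* This minimises the exponent [(p * N) * (a ^+ 2 - a * eta)], with value
   [- eta ^+ 2 * (p * N) / 4]. *)
pose a : R := eta / 2.
have a0 : 0 <= a by rewrite /a; lra.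
(* This follows from [expR (- a) <= 1 / (1 + a)] and [(1 + a) * (1 - a + a ^+ 2) = 1 + a ^+ 3]. *)
have ea : expR (- a) - 1 <= - a + a ^+ 2.
  have h : expR a * expR (- a) = 1 by rewrite -expRD subrr expR0.
  have : 1 + a <= expR a by exact: expR_ge1Dx.
  have := expR_ge0 (- a); nra.
set N : R := #|W|%:R; have N0 : 0 <= N by rewrite ler0n.
have pN0 : 0 <= p * N by rewrite mulr_ge0.
apply: (@le_trans _ _ (rs_exp (fun J => expR (a * ((1 - eta) * (p * N))) *
   (1 * expR (- a * #|J :&: W|%:R))))).
  apply: rs_exp_le => J _.
  case: ltP => [lt|_] /=; last by rewrite mul1r mulr_ge0 ?expR_ge0.
  rewrite mul1r -expRD; apply: le_trans (expR_ge1Dx _).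
  rewrite lerDl mulNr -mulrBr mulr_ge0 // subr_ge0; exact: ltW.
rewrite rs_expZ.
apply: le_trans (_ : expR (a * ((1 - eta) * (p * N))) *
   (expR (p * (expR (- a) - 1) * N) * rs_exp (fun=> 1)) <= _).
  by rewrite ler_wpM2l ?expR_ge0 // rs_mgf_le.
rewrite rs_exp1 mulr1 -expRD ler_expR.
have -> : p * (expR (- a) - 1) * N = (p * N) * (expR (- a) - 1) by ring.
have : (p * N) * (expR (- a) - 1) <= (p * N) * (- a + a ^+ 2) by rewrite ler_wpM2l.
rewrite /a; nra.
Qed.

End RandomSubset.

(** * The template graph and its blow-ups *)

(** The shift graph; pairs that are not increasing are kept as isolated vertices, so that the vertex
    type is a plain product. *)
Definition shift_rel (q : nat) : rel ('I_q * 'I_q) :=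
  fun x y => [&& (x.1 < x.2)%N, (y.1 < y.2)%N & (x.2 == y.1) || (y.2 == x.1)].

Lemma shift_rel_sym q : symmetric (@shift_rel q).
Proof. by move=> x y; rewrite /shift_rel orbC andbCA. Qed.

(** In a triangle, the interval with the least left end would end where both others begin; but
    adjacent intervals begin at different points. *)
Lemma shift_rel_triangle_free q (x y z : 'I_q * 'I_q) :
  ~~ [&& shift_rel x y, shift_rel y z & shift_rel x z].
Proof. rewrite /shift_rel -!val_eqE /=; lia. Qed.

(* The sets of colours used on the pairs [(j, k)], [k > j], are distinct for
   distinct [j]. *)
Lemma shift_rel_not_colorable r (f : 'I_(2 ^ r).+1 * 'I_(2 ^ r).+1 -> 'I_r) :
  exists x y, shift_rel x y /\ f x = f y.
Proof.
pose S (j : 'I_(2 ^ r).+1) : {set 'I_r} := [set f (j, k) | k : 'I__ & (j < k)%N].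
have /injectivePn[i [j]] : ~~ injectiveb S.
  (* There are [2 ^ r + 1] indices but only [2 ^ r] sets of colours. *)
  apply/negP => /injectiveP injS.
  have := leq_card S injS; rewrite card_ord -cardsT -powersetT card_powerset cardsT card_ord.
  by rewrite ltnn.
wlog ij : i j / (i < j)%N => [wl|_ Sij].
  move=> ij Sij; have [lt|gt|eq] := ltngtP i j.
  - exact: (wl i j).
  - by apply: (wl j i) => //; rewrite eq_sym.
  - by move/eqP: ij; case; apply/val_inj.
have : f (i, j) \in S j by rewrite -Sij; apply/imsetP; exists j; rewrite ?inE.
case/imsetP => k; rewrite inE => jk fE.
by exists (i, j), (j, k); split => //; rewrite /shift_rel /= ij jk eqxx.
Qed.

Lemma template_exists r : exists t (T : rel 'I_t),
  [/\ (0 < t)%N, symmetric T,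
      forall x y z, ~~ [&& T x y, T y z & T x z] &
      forall f : 'I_t -> 'I_r, exists x y, T x y /\ f x = f y].
Proof.
pose X := ('I_(2 ^ r).+1 * 'I_(2 ^ r).+1)%type.
exists #|{: X}|, (fun i j => shift_rel (enum_val i) (enum_val j)); split.
- by apply/card_gt0P; exists (ord0, ord0).
- by move=> i j; apply: shift_rel_sym.
- by move=> i j k; apply: shift_rel_triangle_free.
- move=> f; have [x [y [xy fxy]]] := shift_rel_not_colorable (fun x => f (enum_rank x)).
  by exists (enum_rank x), (enum_rank y); rewrite !enum_rankK.
Qed.

Section EdgePairs.
Variable V : finType.

Lemma set2_eq (x y a b : V) : [set x; y] = [set a; b] ->
  (x = a /\ y = b) \/ (x = b /\ y = a).
Proof.
move=> E.
have := finset.set21 x y; have := finset.set22 x y; rewrite E !inE.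
have := finset.set21 a b; have := finset.set22 a b; rewrite -E !inE.
do 4![case/orP => /eqP ?]; subst; auto.
Qed.

Lemma card_le_edge_image (Q : {set V * V}) :
  (#|Q| <= 2 * #|[set [set q.1; q.2] | q in Q]|)%N.
Proof.
set E := [set [set q.1; q.2] | q in Q].
rewrite -sum1_card (partition_big (fun q => [set q.1; q.2]) (mem E)) /=; last first.
  by move=> q qQ; apply/imsetP; exists q.
rewrite mulnC -sum_nat_const; apply: leq_sum => e /imsetP[[a b] abQ ->] /=.
rewrite sum1_card.
apply: leq_trans (_ : #|[set (a, b); (b, a)]| <= _)%N; last first.
  by rewrite cards2; case: (_ != _).
apply/subset_leq_card/fintype.subsetP => -[x y]; rewrite !inE /= => /andP[_ /eqP].
by case/set2_eq => /= -[-> ->]; rewrite eqxx ?orbT.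
Qed.

End EdgePairs.

(** * Blow-ups of the template and their monochromatic edges *)

Section BlockGraph.
Variables (n t m r : nat) (T : rel 'I_t).
Hypotheses (t0 : (0 < t)%N) (m0 : (0 < m)%N).
Hypothesis T_not_colorable : forall f : 'I_t -> 'I_r, exists x y, T x y /\ f x = f y.

Definition left_side : {set 'I_n} := [set x : 'I_n | (x < n./2)%N].

(** Vertices are cut, in index order, into runs of length [m]; run number k stands for template
    vertex k mod [t] in block k div [t]. *)
Definition vclass (x : 'I_n) : 'I_t := Ordinal (ltn_pmod (x %/ m) t0).

Definition vblock (x : 'I_n) : nat := (x %/ m %/ t)%N.

Definition block_rel : rel 'I_n := fun x y =>
  [&& x \in left_side, y \in left_side, vblock x == vblock y &
      T (vclass x) (vclass y)].

Lemma card_block b : (#|[set y : 'I_n | vblock y == b]| <= t * m)%N.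
Proof.
have tm0 : (0 < m * t)%N by rewrite muln_gt0 m0.
(* A block is an interval of length at most [m * t], on which the residue is injective. *)
pose g (y : 'I_n) : 'I_(m * t) := Ordinal (ltn_pmod y tm0).
rewrite -[leqRHS]card_ord mulnC -(@card_in_imset _ _ g); first exact: max_card.
move=> x y; rewrite !inE /vblock -!divnMA => /eqP xb /eqP yb [xy].
by apply/val_inj; rewrite /= (divn_eq x (m * t)) (divn_eq y (m * t)) xb yb xy.
Qed.

Lemma card_block_nbr x : (#|[set y | block_rel x y]| <= t * m)%N.
Proof.
apply: leq_trans (card_block (vblock x)).
apply/subset_leq_card/fintype.subsetP => y; rewrite !inE /block_rel.
by case/and4P => _ _ /eqP ->.
Qed.

Lemma card_block_rel : (#|[set q : 'I_n * 'I_n | block_rel q.1 q.2]| <= n * (t * m))%N.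
Proof.
rewrite -sum1dep_card -(pair_big_dep xpredT (fun x y => block_rel x y) (fun _ _ => 1%N)) /=.
rewrite -[X in (_ <= X * _)%N](card_ord n) -sum_nat_const; apply: leq_sum => x _.
by rewrite sum1dep_card card_block_nbr.
Qed.

Definition vcell (b : nat) (i : 'I_t) : {set 'I_n} :=
  [set x in left_side | (vblock x == b) && (vclass x == i)].

Lemma card_vcell b i : (b < n./2 %/ (t * m))%N -> (m <= #|vcell b i|)%N.
Proof.
move=> bN.
(* The bound on [b] says that its block lies entirely in the left half, so the cell contains a full
   run of [m] vertices. *)
have ltb (j : 'I_m) : ((b * t + i) * m + j < n./2)%N.
  have : (b.+1 * (t * m) <= n./2)%N by rewrite -leq_divRL // muln_gt0 t0.
  have : ((b * t + i).+1 * m <= b.+1 * t * m)%N.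
    by rewrite leq_mul2r; apply/orP; right; have := ltn_ord i; nia.
  have := ltn_ord j; nia.
have ltn_half j : ((b * t + i) * m + j < n./2)%N -> ((b * t + i) * m + j < n)%N.
  move=> h; apply: leq_trans h _; rewrite -divn2; exact: leq_div.
pose g (j : 'I_m) : 'I_n := Ordinal (ltn_half j (ltb j)).
have dg j : (g j %/ m = b * t + i)%N by rewrite /= divnMDl // divn_small ?addn0.
rewrite -[leqLHS]card_ord -(@card_imset _ _ g); last first.
  by move=> j k [] /addnI /val_inj.
apply/subset_leq_card/fintype.subsetP => x /imsetP[j _ ->].
rewrite !inE ltb /vblock dg divnMDl // divn_small // addn0 eqxx /=.
apply/eqP/val_inj; rewrite /= -[((_ + j) %/ m)%N]/(g j %/ m)%N dg.
by rewrite modnMDl modn_small.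
Qed.

Lemma majority_colour (C : {set 'I_n}) (f : 'I_n -> 'I_r) : (0 < r)%N ->
  exists c, (#|C| <= r * #|[set x in C | f x == c]|)%N.
Proof.
case: r f => // r' f _.
pose k c := #|[set x in C | f x == c]|.
exists [arg max_(c > ord0) k c]; case: arg_maxnP => // c _ kmax.
rewrite -sum1_card (partition_big f xpredT) //=.
rewrite -[X in (_ <= X * _)%N](card_ord r'.+1) -sum_nat_const; apply: leq_sum => c' _; apply: leq_trans (kmax c' isT).
by rewrite /k -sum1dep_card.
Qed.

Hypotheses (r0 : (0 < r)%N) (T_sym : symmetric T).

Lemma block_rel_sym : symmetric block_rel.
Proof. by move=> x y; rewrite /block_rel T_sym eq_sym andbCA. Qed.

Definition mono_pairs (f : 'I_n -> 'I_r) : {set 'I_n * 'I_n} :=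
  [set q | block_rel q.1 q.2 & f q.1 == f q.2].

(** The majority colours of the cells colour the template, so two adjacent cells share a majority
    colour; all pairs between their majority parts are monochromatic. *)
Lemma card_mono_block (f : 'I_n -> 'I_r) b : (b < n./2 %/ (t * m))%N ->
  (m ^ 2 <= r ^ 2 * #|[set q in mono_pairs f | vblock q.1 == b]|)%N.
Proof.
move=> bN.
have maj i := majority_colour (vcell b i) f r0.
have [g gP] := boolp.choice maj.
have [i [j [Tij gij]]] := T_not_colorable g.
pose X k := [set x in vcell b k | f x == g k].
have mX k : (m <= r * #|X k|)%N := leq_trans (card_vcell k bN) (gP k).
apply: leq_trans (_ : (r * #|X i|) * (r * #|X j|) <= _)%N.
  by rewrite expnS expn1 leq_mul.
rewrite mulnACA mulnn leq_mul2l -cardsX; apply/orP; right.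
apply/subset_leq_card/fintype.subsetP => -[x y]; rewrite !inE /= /block_rel !inE.
case/andP => /andP[/and3P[-> /eqP xb /eqP xi] /eqP fx] /andP[/and3P[-> /eqP yb /eqP yj] /eqP fy].
by rewrite xb yb xi yj Tij fx fy gij !eqxx.
Qed.

Lemma card_mono_pairs (f : 'I_n -> 'I_r) :
  (n./2 %/ (t * m) * m ^ 2 <= r ^ 2 * #|mono_pairs f|)%N.
Proof.
set N := (n./2 %/ _)%N.
apply: leq_trans (_ : r ^ 2 * \sum_(b < N) #|[set q in mono_pairs f | vblock q.1 == b]| <= _)%N.
  rewrite -[X in (X * _ <= _)%N](card_ord N) -sum_nat_const big_distrr /=.
  by apply: leq_sum => b _; apply: card_mono_block.
rewrite leq_mul2l; apply/orP; right.
under eq_bigr do rewrite -sum1dep_card big_mkcondr /=.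
(* Double counting: a pair is counted in at most one block. *)
rewrite exchange_big /= -[leqRHS]sum1_card; apply: leq_sum => q _.
rewrite -big_mkcond /= sum1dep_card.
have [b0 hb0|none] := pickP (fun b : 'I_N => vblock q.1 == b).
  rewrite -(cards1 b0); apply/subset_leq_card/fintype.subsetP => b; rewrite !inE.
  by move=> /eqP hb; apply/eqP/val_inj; rewrite /= -hb (eqP hb0).
by rewrite eq_card0 // => b; rewrite inE none.
Qed.

(** [U] will be the set of heavy vertices, whose edges inside the blocks are dropped. *)
Definition mono_pairs_off (f : 'I_n -> 'I_r) (U : {set 'I_n}) : {set 'I_n * 'I_n} :=
  [set q in mono_pairs f | (q.1 \notin U) && (q.2 \notin U)].

Lemma card_block_touch (U : {set 'I_n}) :
  (#|[set q : 'I_n * 'I_n | block_rel q.1 q.2 & q.1 \in U]| <= #|U| * (t * m))%N.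
Proof.
rewrite -sum1dep_card (eq_bigl (fun q : 'I_n * 'I_n => (q.1 \in U) && block_rel q.1 q.2)); last first.
  by move=> q; rewrite andbC.
rewrite -(pair_big_dep (mem U) (fun x y => block_rel x y) (fun _ _ => 1%N)) /=.
rewrite -sum_nat_const; apply: leq_sum => x _.
by rewrite sum1dep_card card_block_nbr.
Qed.

Lemma card_mono_pairs_off (f : 'I_n -> 'I_r) (U : {set 'I_n}) :
  (#|mono_pairs f| <= #|mono_pairs_off f U| + 2 * (#|U| * (t * m)))%N.
Proof.
pose B1 := [set q : 'I_n * 'I_n | block_rel q.1 q.2 & q.1 \in U].
pose B2 := [set q : 'I_n * 'I_n | block_rel q.1 q.2 & q.2 \in U].
have swapK : involutive (fun q : 'I_n * 'I_n => (q.2, q.1)) by case.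
have B12 : #|B2| = #|B1|.
  rewrite -(card_imset B1 (inv_inj swapK)); apply: eq_card => q.
  apply/idP/imsetP => [qB|[q' q'B ->]]; last first.
    by rewrite inE /= block_rel_sym; rewrite inE in q'B.
  by exists (q.2, q.1); [rewrite inE /= block_rel_sym; rewrite inE in qB | case: (q)].
have := card_block_touch U; rewrite -/B1 => B1le.
apply: leq_trans (_ : #|mono_pairs_off f U :|: (B1 :|: B2)| <= _)%N.
  apply/subset_leq_card/fintype.subsetP => q; rewrite !inE => /andP[-> ->] /=.
  by case: (q.1 \in U); case: (q.2 \in U).
rewrite cardsU; apply: leq_trans (leq_subr _ _) _; rewrite leq_add2l.
by rewrite cardsU B12; apply: leq_trans (leq_subr _ _) _; rewrite mul2n -addnn leq_add.
Qed.

Definition mono_edges (f : 'I_n -> 'I_r) (U : {set 'I_n}) : {set {set 'I_n}} :=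
  [set [set q.1; q.2] | q in mono_pairs_off f U].

Lemma card_mono_edges (f : 'I_n -> 'I_r) (U : {set 'I_n}) :
  (n./2 %/ (t * m) * m ^ 2 <= r ^ 2 * (2 * (#|mono_edges f U| + #|U| * (t * m))))%N.
Proof.
apply: leq_trans (card_mono_pairs f) _; rewrite leq_mul2l; apply/orP; right.
apply: leq_trans (card_mono_pairs_off f U) _; rewrite mulnDr leq_add2r.
exact: card_le_edge_image.
Qed.

End BlockGraph.

(** * Construction of the triangle-free subgraph *)

Section RelGraph.
Variables (V : finType) (h : rel V).
Hypotheses (h_sym : symmetric h) (h_irr : irreflexive h).

Definition rel_edges : {set {set V}} :=
  [set e in pairs V | [exists x, exists y, (e == [set x; y]) && h x y]].

Lemma rel_edges_sub : rel_edges \subset pairs V.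
Proof. by apply/fintype.subsetP => e; rewrite inE => /andP[]. Qed.

Definition rel_graph : sgraph V := SGraph rel_edges_sub.

Lemma adj_rel_graph x y : adj rel_graph x y = h x y.
Proof.
rewrite /adj !inE; apply/andP/idP => [[_ /existsP[a /existsP[b /andP[/eqP E hab]]]]|hxy].
  by case: (set2_eq E) => -[-> ->]; rewrite // h_sym.
split; last by apply/existsP; exists x; apply/existsP; exists y; rewrite eqxx.
by rewrite cards2; have [xy|//] := eqVneq x y; rewrite xy h_irr in hxy.
Qed.

End RelGraph.

(** * Neighbourhoods and stars in a set of edges *)

Section Nbr.
Variable V : finType.
Implicit Types (J : {set {set V}}) (S : {set V}).

Definition eadj J (x y : V) : bool := [set x; y] \in J.

Lemma eadj_sym J : symmetric (eadj J).
Proof. by move=> x y; rewrite /eadj finset.setUC. Qed.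

Definition nbr J (x : V) : {set V} := [set y | eadj J x y].

Definition star (x : V) S : {set {set V}} := [set [set x; y] | y in S].

Lemma star_inj (x : V) : injective (fun y => [set x; y]).
Proof. by move=> y z /set2_eq[[]|[-> ->]]. Qed.

Lemma card_star x S : #|star x S| = #|S|.
Proof. exact/card_imset/star_inj. Qed.

Lemma star_sub_pairs x S : x \notin S -> star x S \subset pairs V.
Proof.
move=> xS; apply/fintype.subsetP => e /imsetP[y yS ->]; rewrite inE cards2.
by have [xy|//] := eqVneq x y; rewrite xy yS in xS.
Qed.

(** This turns a degree into the number of random edges in a set of pairs, the form that the tail
    bounds take. *)
Lemma card_star_inter J x S : #|J :&: star x S| = #|nbr J x :&: S|.
Proof.
rewrite -[RHS](card_star x); apply: eq_card => e; rewrite inE.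
apply/andP/imsetP => [[eJ /imsetP[y yS eE]]|[y]].
  by exists y => //; rewrite !inE yS andbT /eadj -eE.
rewrite !inE => /andP[xy yS] ->; split=> //; exact: imset_f.
Qed.

Lemma eadj_setU1 J x y a b : [set a; b] != [set x; y] ->
  eadj ([set a; b] |: J) x y = eadj (J :\ [set a; b]) x y.
Proof. by move=> ne; rewrite /eadj !inE eq_sym (negbTE ne). Qed.

End Nbr.

Section Construction.
Variables (R : realType) (n t m r : nat) (T : rel 'I_t) (Dg : R).
Hypotheses (t0 : (0 < t)%N) (T_sym : symmetric T).
Hypothesis T_triangle_free : forall x y z, ~~ [&& T x y, T y z & T x z].

Local Notation V := 'I_n.
Local Notation brel := (@block_rel n t m T t0).
Local Notation lside := (left_side n).
Implicit Types (J : {set {set V}}) (x y u v w : V).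

Definition brel_of J : rel V := fun x y => eadj J x y && brel x y.

(* In the notation of the header, [brel] is K, [light_rel J] is F and
   [final_rel J] is H, where [J] is the edge set of Gamma. *)
Definition heavy J : {set V} := [set x | Dg < #|[set y | brel_of J x y]|%:R].

Definition light_rel J : rel V :=
  fun x y => [&& brel_of J x y, x \notin heavy J & y \notin heavy J].

Definition bad_right J u : {set V} :=
  [set y in ~: lside | [exists w, light_rel J u w && eadj J w y]].

(** Splitting by the class [i] of [u] gives independence: the middle vertex [w] is then of another
    class, so the edges from [v] to class [i] do not influence this set. *)
Definition bad_left J v i : {set V} :=
  [set u in lside | (vclass m t0 u == i) &&
     [exists w, light_rel J u w && eadj J w v]].

Definition cross_rel J : rel V := fun x y =>
  [&& x \in lside, y \notin lside, eadj J x y & y \notin bad_right J x].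

Definition final_rel J : rel V := fun x y =>
  [|| light_rel J x y, cross_rel J x y | cross_rel J y x].

Lemma T_irr : irreflexive T.
Proof. by move=> x; have := T_triangle_free x x x; case: (T x x). Qed.

Lemma brel_sides x y : brel x y -> [/\ x \in lside, y \in lside & T (vclass m t0 x) (vclass m t0 y)].
Proof. by case/and4P => -> -> _ ->. Qed.

Lemma light_rel_brel J x y : light_rel J x y -> brel x y.
Proof. by case/and3P => /andP[]. Qed.

Lemma light_rel_eadj J x y : light_rel J x y -> eadj J x y.
Proof. by case/and3P => /andP[]. Qed.

Lemma light_rel_sym J : symmetric (light_rel J).
Proof.
move=> x y; rewrite /light_rel /brel_of eadj_sym (block_rel_sym _ _ T_sym).
by rewrite [X in _ && X]andbC.
Qed.

Lemma final_rel_sym J : symmetric (final_rel J).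
Proof. by move=> x y; rewrite /final_rel light_rel_sym [X in _ || X]orbC. Qed.

Lemma final_rel_irr J : irreflexive (final_rel J).
Proof.
move=> x; rewrite /final_rel /cross_rel; case: (x \in lside) => /=; rewrite orbF;
by apply/negP => /light_rel_brel /brel_sides[_ _]; rewrite T_irr.
Qed.

Lemma final_rel_eadj J x y : final_rel J x y -> eadj J x y.
Proof.
case/or3P => [/light_rel_eadj //|/and4P[] //|/and4P[_ _]].
by rewrite eadj_sym.
Qed.

Lemma final_rel_left J x y : x \in lside -> y \in lside ->
  final_rel J x y = light_rel J x y.
Proof. by move=> xA yA; rewrite /final_rel /cross_rel xA yA /= ?orbF. Qed.

Lemma final_rel_cross J x y : x \in lside -> y \notin lside ->
  final_rel J x y = eadj J x y && (y \notin bad_right J x).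
Proof.
move=> xA yA; rewrite /final_rel /cross_rel xA (negbTE yA) /= orbF.
case: (boolP (light_rel J x y)) => // /light_rel_brel /brel_sides[_].
by rewrite (negbTE yA).
Qed.

Lemma final_rel_right J x y : x \notin lside -> y \notin lside -> final_rel J x y = false.
Proof.
move=> xA yA; rewrite /final_rel /cross_rel (negbTE xA) (negbTE yA) /= orbF.
by apply/negP => /light_rel_brel /brel_sides[]; rewrite (negbTE xA).
Qed.

(** The path through the light edge [xy] puts [z] in [bad_right J x], so the edge [xz] has been
    deleted. *)
Lemma final_rel_no_triangle_cross J x y z :
  x \in lside -> y \in lside -> z \notin lside ->
  ~~ [&& final_rel J x y, final_rel J y z & final_rel J x z].
Proof.
move=> xA yA zA; apply/negP => /and3P[].
rewrite final_rel_left // !final_rel_cross // => xy /andP[yz _] /andP[_ /negP].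
case; rewrite !inE in zA *; rewrite zA /=.
by apply/existsP; exists y; rewrite xy.
Qed.

Lemma final_rel_triangle_free J : triangle_free (rel_graph (final_rel J)).
Proof.
apply/negP => /existsP[x /existsP[y /existsP[z]]].
rewrite !(adj_rel_graph (final_rel_sym J) (final_rel_irr J)) => H3.
have sym := final_rel_sym J.
(* Three left vertices would map to a triangle of [T], and two right ones are never adjacent; the
   case of exactly one right vertex is the previous lemma up to symmetry. *)
have [xA|xA] := boolP (x \in lside); have [yA|yA] := boolP (y \in lside);
  have [zA|zA] := boolP (z \in lside).
- case/and3P: H3; rewrite !final_rel_left // => /light_rel_brel/brel_sides[_ _ xy].
  move=> /light_rel_brel/brel_sides[_ _ yz] /light_rel_brel/brel_sides[_ _ xz].
  by move: (T_triangle_free (vclass m t0 x) (vclass m t0 y) (vclass m t0 z)); rewrite xy yz xz.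
- by move: H3; apply/negP; apply: final_rel_no_triangle_cross.
- case/and3P: H3 => xy yz xz.
  by have := final_rel_no_triangle_cross J xA zA yA; rewrite xz sym yz xy.
- by move: H3; rewrite (final_rel_right J yA zA) andbF.
- case/and3P: H3 => xy yz xz.
  by have := final_rel_no_triangle_cross J yA zA xA; rewrite yz sym xz sym xy.
- by case/and3P: H3 => _ _; rewrite (final_rel_right J xA zA).
- by case/and3P: H3; rewrite (final_rel_right J xA yA).
- by case/and3P: H3; rewrite (final_rel_right J xA yA).
Qed.

Lemma card_light_nbr J x : 0 <= Dg -> #|[set y | light_rel J x y]|%:R <= Dg.
Proof.
move=> Dg0; have [xh|xh] := boolP (x \in heavy J).
  rewrite (_ : [set y | light_rel J x y] = finset.set0) ?cards0 //.
  by apply/setP => y; rewrite !inE /light_rel xh andbF.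
apply: le_trans (_ : #|[set y | brel_of J x y]|%:R <= _).
  rewrite ler_nat; apply/subset_leq_card/fintype.subsetP => y; rewrite !inE.
  by case/and3P.
by rewrite inE -leNgt in xh.
Qed.

Lemma card_le_cover (X Y : {set V}) (P : rel V) (d : R) :
  (forall y, y \in Y -> exists2 x, x \in X & P x y) ->
  (forall x, x \in X -> #|[set y | P x y]|%:R <= d) ->
  #|Y|%:R <= #|X|%:R * d.
Proof.
move=> cov dP.
apply: le_trans (_ : (\sum_(x in X) #|[set y | P x y]|)%:R <= _); last first.
  by rewrite natr_sum mulr_natl -sumr_const; apply: ler_sum.
rewrite ler_nat -sum1_card.
under [leqRHS]eq_bigr do rewrite -sum1dep_card big_mkcond.
rewrite exchange_big /= [leqLHS]big_mkcond; apply: leq_sum => y _.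
case: ifP => // /cov[x xX Pxy]; rewrite (bigD1 x) //= Pxy; lia.
Qed.

Variables (d L ell : R).
Hypotheses (Dg0 : 0 <= Dg) (d0 : 0 <= d).

Lemma card_bad_right J u : (forall x, #|nbr J x|%:R <= d) ->
  #|bad_right J u|%:R <= Dg * d.
Proof.
move=> degJ.
apply: le_trans (_ : #|[set w | light_rel J u w]|%:R * d <= _); last first.
  by rewrite ler_wpM2r // card_light_nbr.
apply: (card_le_cover (P := eadj J)) => [y|x _]; last exact: degJ.
rewrite !inE => /andP[_ /existsP[w /andP[uw wy]]]; exists w => //; by rewrite inE.
Qed.

(** The set is reached from [v] by first choosing one of at most [d] neighbours, then one of at most
    [Dg] light neighbours of it. *)
Lemma card_bad_left J v i : (forall x, #|nbr J x|%:R <= d) ->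
  #|bad_left J v i|%:R <= Dg * d.
Proof.
move=> degJ; rewrite mulrC.
apply: le_trans (_ : #|nbr J v|%:R * Dg <= _); last by rewrite ler_wpM2r.
apply: (card_le_cover (P := light_rel J)) => [u|x _]; last exact: card_light_nbr.
rewrite !inE => /and3P[_ _ /existsP[w /andP[uw wv]]]; exists w.
  by rewrite inE eadj_sym.
by rewrite light_rel_sym.
Qed.

Lemma final_degree J x : (forall x, #|nbr J x|%:R <= d) -> 0 <= L ->
  (x \in lside -> ell <= #|nbr J x :&: ~: lside|%:R) ->
  (x \notin lside -> ell <= #|nbr J x :&: lside|%:R) ->
  (x \in lside -> #|bad_right J x|%:R <= Dg * d ->
     #|nbr J x :&: bad_right J x|%:R <= L) ->
  (forall i, x \notin lside -> #|bad_left J x i|%:R <= Dg * d ->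
     #|nbr J x :&: bad_left J x i|%:R <= L) ->
  ell - t%:R * L <= (degree (rel_graph (final_rel J)) x)%:R.
Proof.
move=> degJ L0 ellA ellB badA badB.
rewrite /degree.
set N := [set y | _]; have NE : N = [set y | final_rel J x y].
  by apply/setP => y; rewrite !inE (adj_rel_graph (final_rel_sym J) (final_rel_irr J)).
rewrite NE {N NE}; set N := [set y | _].
have tL : L <= t%:R * L by rewrite ler_peMl // ler1n.
rewrite lerBlDr.
have [xA|xA] := boolP (x \in lside).
  apply: le_trans (ellA xA) _.
  apply: le_trans (_ : #|N|%:R + #|nbr J x :&: bad_right J x|%:R <= _); last first.
    by rewrite lerD2l (le_trans _ tL) // badA // card_bad_right.
  rewrite -natrD ler_nat; apply: leq_trans (_ : #|N :|: nbr J x :&: bad_right J x| <= _)%N.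
    apply/subset_leq_card/fintype.subsetP => y; rewrite inE => /andP[xy].
    rewrite inE => yA; rewrite inE [y \in N]inE final_rel_cross // [y \in _ :&: _]inE xy.
    by rewrite inE in xy; rewrite xy /= orNb.
  by rewrite cardsU leq_subr.
apply: le_trans (ellB xA) _.
apply: le_trans (_ : #|N|%:R + \sum_(i < t) #|nbr J x :&: bad_left J x i|%:R <= _); last first.
  rewrite lerD2l mulr_natl -[X in _ *+ X](card_ord t) -sumr_const.
  by apply: ler_sum => i _; apply: badB => //; exact: card_bad_left.
rewrite -natr_sum -natrD ler_nat.
(* A left neighbour [y] lost by [x] lies in the bad set for its own class; summing over the [t]
   classes gives the loss [t%:R * L]. *)
apply: leq_trans (_ : #|N :|: \bigcup_(i < t) (nbr J x :&: bad_left J x i)| <= _)%N.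
  apply/subset_leq_card/fintype.subsetP => y; rewrite inE => /andP[xy yA].
  rewrite inE [y \in N]inE final_rel_sym final_rel_cross //.
  have xy' : eadj J x y by rewrite inE in xy.
  rewrite eadj_sym xy' /=.
  have [yb|//] := boolP (x \in bad_right J y).
  apply/bigcupP; exists (vclass m t0 y) => //.
  rewrite inE xy /=; move: yb; rewrite inE => /andP[_ ex].
  by rewrite [y \in _]inE yA eqxx.
rewrite cardsU; apply: leq_trans (leq_subr _ _) _; rewrite leq_add2l.
elim/big_ind2: _ => [|A1 a1 A2 a2 h1 h2|i _] //; first by rewrite cards0.
by rewrite cardsU; apply: leq_trans (leq_subr _ _) (leq_add h1 h2).
Qed.

(** A proper colouring [f] after deleting [D] forces [D] to contain every edge of [J] that [f] makes
    monochromatic off the heavy set, since all of these belong to the light graph. *)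
Lemma final_not_partite J (D : {set {set V}}) :
  (forall f : V -> 'I_r,
     (#|D| < #|J :&: mono_edges m T t0 f (heavy J)|)%N) ->
  ~~ partite r (del_edges (rel_graph (final_rel J)) D).
Proof.
move=> big; apply/negP => /existsP[f /forallP fP].
have := big f; rewrite ltnNge => /negP; case.
apply/subset_leq_card/fintype.subsetP => e; rewrite inE => /andP[eJ /imsetP[[x y] xy eE]].
move: xy; rewrite 2!inE /= => /andP[/andP[xy /eqP fxy] /andP[xU yU]].
have hxy : adj (rel_graph (final_rel J)) x y.
  rewrite (adj_rel_graph (final_rel_sym J) (final_rel_irr J)).
  by rewrite /final_rel /light_rel /brel_of xy xU yU /eadj -eE eJ.
apply/negPn/negP => eD.
rewrite /adj -eE in hxy.
have := forallP (fP x) y; rewrite fxy eqxx implybF /adj -eE => /negP; case.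
by rewrite finset.in_setD eD.
Qed.

(** Markov's inequality for degrees: the degree sum counts each edge of [J] in the block graph at
    most twice. *)
Lemma card_heavy J :
  #|heavy J|%:R * Dg <=
    (2 * #|J :&: [set [set q.1; q.2] | q in [set q : V * V | brel q.1 q.2]]|)%:R.
Proof.
pose Q := [set q : V * V | brel_of J q.1 q.2].
apply: le_trans (_ : #|Q|%:R <= _).
  have -> : #|Q| = (\sum_x #|[set y | brel_of J x y]|)%N.
    rewrite -sum1dep_card -(pair_big_dep xpredT (fun x y => brel_of J x y) (fun _ _ => 1%N)) /=.
    by apply: eq_bigr => x _; rewrite sum1dep_card.
  rewrite natr_sum (bigID (mem (heavy J))) /=.
  rewrite mulr_natl -sumr_const -[leLHS]addr0 lerD //; last by rewrite sumr_ge0.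
  by apply: ler_sum => x; rewrite inE => /ltW.
rewrite ler_nat; apply: leq_trans (card_le_edge_image Q) _.
rewrite leq_mul2l /=; apply/subset_leq_card/fintype.subsetP => e.
move=> /imsetP[q]; rewrite inE => /andP[qJ qb] ->; rewrite inE; apply/andP; split=> //.
by apply/imsetP; exists q; rewrite ?inE.
Qed.

Lemma light_rel_congr J J' :
  (forall x y, brel x y -> eadj J x y = eadj J' x y) -> light_rel J =2 light_rel J'.
Proof.
move=> E; have E1 x y : brel_of J x y = brel_of J' x y.
  rewrite /brel_of; have [/E->//|] := boolP (brel x y); by rewrite !andbF.
have E2 x : (x \in heavy J) = (x \in heavy J').
  by rewrite !inE; under eq_finset do rewrite E1.
by move=> x y; rewrite /light_rel E1 !E2.
Qed.

(* The edges from [u] to the right side affect neither the light graph nor the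
   adjacencies between light neighbours of [u] and the right side. *)
Lemma bad_right_resample J u e : u \in lside -> e \in star u (~: lside) ->
  bad_right (e |: J) u = bad_right (J :\ e) u.
Proof.
move=> uA /imsetP[v vA ->]; rewrite inE in vA.
have congr x y : (x != u) || (y \in lside) -> x \in lside ->
    eadj ([set u; v] |: J) x y = eadj (J :\ [set u; v]) x y.
  move=> xy xA; apply: eadj_setU1; apply/eqP => /set2_eq[] [ux vy].
    by move: xy; rewrite ux eqxx /= -vy (negbTE vA).
  by rewrite vy xA in vA.
have lightE := light_rel_congr (J := [set u; v] |: J) (J' := J :\ [set u; v]).
rewrite /bad_right; apply/setP => y; rewrite !inE; congr (_ && _).
apply: eq_existsb => w; rewrite lightE; last first.
  by move=> x z /brel_sides[xA zA _]; apply: congr; rewrite ?zA ?orbT.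
have [uw|//] := boolP (light_rel _ u w).
have [_ wA Tuw] := brel_sides (light_rel_brel uw).
by rewrite /= congr //; case: eqVneq Tuw => // ->; rewrite T_irr.
Qed.

(** The edge [e] crosses the halves, so the light graph ignores it. It could matter only as the
    second edge of a path starting in class [i], but a light neighbour of such a start is not in
    class [i], as [T] has no loops. *)
Lemma bad_left_resample J v i e : v \notin lside ->
  e \in star v [set u in lside | vclass m t0 u == i] ->
  bad_left (e |: J) v i = bad_left (J :\ e) v i.
Proof.
move=> vA /imsetP[u]; rewrite inE => /andP[uA ui] ->.
have congr x y : x \in lside -> (y \in lside) || (x != u) ->
    eadj ([set v; u] |: J) x y = eadj (J :\ [set v; u]) x y.
  move=> xA xy; apply: eadj_setU1; apply/eqP => /set2_eq[] [vx uy].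
    by rewrite vx xA in vA.
  by move: xy; rewrite uy eqxx -vx (negbTE vA).
have lightE := light_rel_congr (J := [set v; u] |: J) (J' := J :\ [set v; u]).
rewrite /bad_left; apply/setP => x; rewrite !inE; congr (_ && _).
have [/eqP xi|//] := boolP (vclass m t0 x == i); congr (_ && _).
apply: eq_existsb => w; rewrite lightE; last first.
  by move=> y z /brel_sides[yA zA _]; apply: congr; rewrite ?zA.
have [xw|//] := boolP (light_rel _ x w).
have [_ wA Txw] := brel_sides (light_rel_brel xw).
rewrite /= congr //; apply/orP; right; apply/eqP => wu.
by move: Txw; rewrite wu xi (eqP ui) T_irr.
Qed.

Lemma bad_right_star J u : star u (bad_right J u) \subset star u (~: lside).
Proof. by apply/imsetS/fintype.subsetP => y; rewrite !inE => /andP[]. Qed.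

Lemma bad_left_star J v i :
  star v (bad_left J v i) \subset star v [set u in lside | vclass m t0 u == i].
Proof. by apply/imsetS/fintype.subsetP => y; rewrite !inE => /and3P[-> -> _]. Qed.

End Construction.

(** * The typical properties of the random graph *)

Section GnpExpectation.
Variables (R : realType) (n : nat) (p : R).
Hypothesis p01 : 0 <= p <= 1.
Local Notation P := (pairs 'I_n).

Lemma rs_exp_gnp (h : {set {set 'I_n}} -> R) :
  rs_exp P p h = \sum_(G : sgraph 'I_n) gnp_mass p G * h (edges G).
Proof.
rewrite /rs_exp (reindex_omap (@edges 'I_n) insub) /=; last first.
  by move=> J JP; rewrite insubT.
by apply: eq_big => [G|G _] //; rewrite edgesP valK eqxx.
Qed.

Lemma gnp_prob_ge_exp (A : pred (sgraph 'I_n)) (bad : pred {set {set 'I_n}}) :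
  (forall G, ~~ bad (edges G) -> A G) ->
  1 - rs_exp P p (fun J => (bad J)%:R) <= gnp_prob p A.
Proof.
move=> badA; rewrite -[X in X - _](rs_exp1 P p) -rs_expB rs_exp_gnp /gnp_prob [leRHS]big_mkcond.
apply: ler_sum => G _.
have mass0 : 0 <= gnp_mass p G := rs_mass_ge0 P p01 (edges G).
case: ifPn => [_|/negP nA] /=; first by rewrite ler_piMr // gerBl ler0n.
have [bG|nb] := boolP (bad (edges G)); first by rewrite subrr mulr0.
by case: nA; apply: badA.
Qed.

Lemma gnp_prob_le1 (A : pred (sgraph 'I_n)) : gnp_prob p A <= 1.
Proof.
rewrite -[leRHS](rs_exp1 P p) rs_exp_gnp /gnp_prob [leLHS]big_mkcond.
apply: ler_sum => G _; rewrite mulr1.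
by case: ifP => // _; exact: (rs_mass_ge0 P p01 (edges G)).
Qed.

End GnpExpectation.

Section UnionBound.
Variables (R : realType) (I : finType) (P : {set I}) (p : R).
Hypothesis p01 : 0 <= p <= 1.

Lemma rs_exp_exists (K : finType) (b : K -> pred {set I}) (eps : R) :
  (forall k, rs_exp P p (fun J => (b k J)%:R) <= eps) ->
  rs_exp P p (fun J => [exists k, b k J]%:R) <= #|K|%:R * eps.
Proof.
move=> beps; rewrite mulr_natl -sumr_const.
apply: le_trans (_ : \sum_(k : K) rs_exp P p (fun J => (b k J)%:R) <= _); last exact: ler_sum.
rewrite -rs_exp_sum; apply: rs_exp_le => // J _.
case: existsP => [[k bk]|_]; last by rewrite sumr_ge0.
by rewrite (bigD1 k) //= bk lerDl sumr_ge0.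
Qed.

Lemma rs_exp_or (a b : pred {set I}) (e1 e2 : R) :
  rs_exp P p (fun J => (a J)%:R) <= e1 -> rs_exp P p (fun J => (b J)%:R) <= e2 ->
  rs_exp P p (fun J => (a J || b J)%:R) <= e1 + e2.
Proof.
move=> ae be; apply: le_trans (lerD ae be); rewrite -rs_expD.
apply: rs_exp_le => // J _; rewrite -natrD ler_nat.
by case: (a J); case: (b J).
Qed.

Lemma rs_exp_false (b : pred {set I}) (eps : R) : 0 <= eps ->
  (forall J, b J = false) -> rs_exp P p (fun J => (b J)%:R) <= eps.
Proof.
move=> eps0 b0; rewrite /rs_exp big1 // => J _; by rewrite b0 mulr0.
Qed.

Lemma rs_upper_tail_const (W : {set I}) (s L : R) : W \subset P ->
  #|W|%:R <= s -> 4 * p * s <= L ->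
  rs_exp P p (fun J => (L <= #|J :&: W|%:R)%R%:R) <= expR (- (L / 4)).
Proof.
move=> WP Ws sL.
apply: le_trans (rs_upper_tail p01 (W := fun=> W) WP _ _ sL) => //.
by apply: rs_exp_le => // J _; rewrite Ws.
Qed.

End UnionBound.

(** * Bad events for a fixed number of vertices *)

Section FixedSize.
Variables (R : realType) (n t m r : nat) (T : rel 'I_t) (p : R).
Variables (Dg L ell eta delta y : R).
Hypotheses (p01 : 0 <= p <= 1) (n0 : (0 < n)%N) (t0 : (0 < t)%N) (m0 : (0 < m)%N).
Hypothesis T_sym : symmetric T.
Hypothesis T_triangle_free : forall x y z, ~~ [&& T x y, T y z & T x z].
Local Notation V := 'I_n.
Local Notation brel := (@block_rel n t m T t0).
Local Notation lside := (left_side n).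
Local Notation medges := (@mono_edges n t m r T t0).
Implicit Types (J : {set {set V}}) (x u v : V).

Hypotheses (Dg0 : 0 < Dg) (L0 : 0 <= L) (eta0 : 0 <= eta).
Hypothesis DgE : 8 * p * (n * (t * m))%:R <= delta * n%:R * Dg.
Hypothesis LE : 4 * p * (Dg * (4 * p * n%:R)) <= L.
Hypothesis ellE : ell <= (1 - eta) * (p * (n./2)%:R).
Hypothesis eta1 : eta <= 1.

Definition opposite x : {set V} := if x \in lside then ~: lside else lside.

Lemma opposite_notin x : x \notin opposite x.
Proof.
by rewrite /opposite; have [xA|//] := boolP (x \in lside); rewrite finset.in_setC xA.
Qed.

Lemma half_le : (n./2 <= n)%N. Proof. by rewrite -divn2 leq_div. Qed.

Lemma card_left : #|lside| = n./2.
Proof.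
rewrite -[RHS]card_ord -(@card_imset _ _ (widen_ord half_le)); last first.
  by move=> i j [] /val_inj.
apply: eq_card => x; apply/idP/imsetP => [|[i _ ->]]; last by rewrite inE /=.
by rewrite inE => xA; exists (Ordinal xA) => //; apply/val_inj.
Qed.

Lemma card_opposite x : (n./2 <= #|opposite x|)%N.
Proof.
rewrite /opposite; case: ifP => _; last by rewrite card_left.
by have := cardsC lside; rewrite card_left card_ord -divn2; lia.
Qed.

Definition bad_degree x J := 4 * p * n%:R <= #|J :&: star x [set~ x]|%:R.
Definition bad_cross x J :=
  #|J :&: star x (opposite x)|%:R < (1 - eta) * (p * #|star x (opposite x)|%:R).
Definition block_edges : {set {set V}} :=
  [set [set q.1; q.2] | q in [set q : V * V | brel q.1 q.2]].
Definition bad_block J := 4 * p * (n * (t * m))%:R <= #|J :&: block_edges|%:R.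
(** The heavy set depends on [J], so the event is stated for every fixed small set in its place, and
    a union bound covers them all. *)
Definition bad_mono (fU : {ffun V -> 'I_r} * {set V}) J :=
  (#|fU.2|%:R <= delta * n%:R) &&
  (#|J :&: medges fU.1 fU.2|%:R < (1 - 1 / 2) * (p * #|medges fU.1 fU.2|%:R)).
Definition bad_vertex (W : {set {set V}} -> {set V}) x J :=
  (#|star x (W J)|%:R <= Dg * (4 * p * n%:R)) && (L <= #|J :&: star x (W J)|%:R).
Definition bad_left_vertex u J :=
  (u \in lside) && bad_vertex (fun J => bad_right m T Dg t0 J u) u J.
Definition bad_right_vertex (vi : V * 'I_t) J :=
  (vi.1 \notin lside) && bad_vertex (fun J => bad_left m T Dg t0 J vi.1 vi.2) vi.1 J.

Definition bad_graph J :=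
  [|| [exists x, bad_degree x J], [exists x, bad_cross x J], bad_block J,
      [exists fU, bad_mono fU J], [exists u, bad_left_vertex u J] |
      [exists vi, bad_right_vertex vi J]].

Local Notation EP := (rs_exp (pairs V) p).

Lemma block_edges_sub : block_edges \subset pairs V.
Proof.
apply/fintype.subsetP => e /imsetP[[x z]]; rewrite !inE /= => xz ->.
rewrite cards2; have [xz'|//] := eqVneq x z.
have := brel_sides xz; rewrite xz' => -[_ _].
by rewrite (T_irr T_triangle_free).
Qed.

Lemma medges_sub f U : medges f U \subset pairs V.
Proof.
apply: fintype.subset_trans block_edges_sub; apply: imsetS.
by apply/fintype.subsetP => q; rewrite !inE => /andP[/andP[-> _] _].
Qed.

(** The deterministic half: outside the bad events, the graph of [final_rel] serves as [H]. *)
Lemma good_graph (gamma c : R) (G : sgraph V) :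
  (1 / 2 - gamma) * p * n%:R <= ell - t%:R * L -> 0 <= gamma ->
  (forall (f : V -> 'I_r) (U : {set V}), #|U|%:R <= delta * n%:R ->
     c * p^-1 * n%:R <= p * #|medges f U|%:R / 2) ->
  ~~ bad_graph (edges G) ->
  [exists H : sgraph V,
    [&& spanning_subgraph H G, triangle_free H,
        (1 / 2 - gamma) * p * n%:R <= (min_degree H)%:R &
        [forall D : {set {set V}},
          (D \subset edges H) && (#|D|%:R < c * p^-1 * n%:R) ==>
          ~~ partite r (del_edges H D)]]].
Proof.
move=> deg_ok gamma0 mono_ok; rewrite !negb_or.
case/and5P => [g1 g2 g3 g4 /andP[g5 g6]].
have {}g1 x := negP (forallP (etrans (esym (negb_exists _)) g1) x).
have {}g2 x := negP (forallP (etrans (esym (negb_exists _)) g2) x).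
have {}g4 k := negP (forallP (etrans (esym (negb_exists _)) g4) k).
have {}g5 k := negP (forallP (etrans (esym (negb_exists _)) g5) k).
have {}g6 k := negP (forallP (etrans (esym (negb_exists _)) g6) k).
case/andP: (p01) => p0 p1.
set J := edges G in g1 g2 g3 g4 g5 g6 *.
have nbrJ x : #|nbr J x|%:R <= 4 * p * n%:R.
  have -> : nbr J x = nbr J x :&: [set~ x].
    have nx : eadj J x x = false.
      apply/negP => /(fintype.subsetP (edgesP G)).
      by rewrite inE cards2 eqxx.
    apply/setP => z; rewrite !inE; have [->|_] := eqVneq z x; last by rewrite andbT.
    by rewrite nx.
  rewrite -card_star_inter; have /negP := g1 x; rewrite -ltNge; exact: ltW.
have cross x : ell <= #|nbr J x :&: opposite x|%:R.
  rewrite -card_star_inter; have /negP := g2 x; rewrite -leNgt; apply: le_trans.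
  apply: le_trans ellE _; rewrite ler_wpM2l ?subr_ge0 // ler_wpM2l // ler_nat.
  by rewrite card_star card_opposite.
(* The block graph has fewer than [4 * p * (n * (t * m))%:R] random edges; [card_heavy] doubles
   this, and [DgE] is tuned to the result. *)
have heavyJ : #|heavy m T Dg t0 J|%:R <= delta * n%:R.
  rewrite -(ler_pM2r Dg0); apply: le_trans DgE.
  apply: le_trans (card_heavy m T Dg t0 J) _; rewrite natrM.
  move: g3; rewrite /bad_block /block_edges -ltNge; lra.
have fsym := final_rel_sym m Dg t0 T_sym J.
have firr := final_rel_irr m Dg t0 T_triangle_free J.
have degH x : (1 / 2 - gamma) * p * n%:R <=
    (degree (rel_graph (final_rel m T Dg t0 J)) x)%:R.
  apply: le_trans deg_ok _.
  apply: (final_degree T_sym T_triangle_free (d := 4 * p * n%:R)) => //.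
  - exact: ltW.
  - by rewrite !mulr_ge0.
  - by move=> xA; have := cross x; rewrite /opposite xA.
  - by move=> xA; have := cross x; rewrite /opposite (negbTE xA).
  - move=> xA small; have := g5 x; rewrite /bad_left_vertex xA /bad_vertex.
    by rewrite card_star small card_star_inter /= => /negP; rewrite -ltNge => /ltW.
  - move=> i xA small; have := g6 (x, i); rewrite /bad_right_vertex xA /bad_vertex.
    by rewrite card_star small card_star_inter /= => /negP; rewrite -ltNge => /ltW.
apply/existsP; exists (rel_graph (final_rel m T Dg t0 J)); apply/and4P; split.
- apply/fintype.subsetP => e; rewrite inE => /andP[_ /existsP[x /existsP[z /andP[/eqP -> h]]]].
  exact: (final_rel_eadj h).
- exact: final_rel_triangle_free.
- rewrite /min_degree; elim/big_ind: _ => [|a b ha hb|x _].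
  (* The default value of the minimum is the number of vertices, which is at least the degree of
     vertex 0. *)
  + apply: le_trans (degH (Ordinal n0)) _.
    by rewrite ler_nat max_card.
  + by rewrite /minn; case: ifP.
  + exact: degH.
- apply/forallP => D; apply/implyP => /andP[_ Dlt].
  apply: final_not_partite => // f.
  rewrite -(ltr_nat R); apply: lt_le_trans Dlt _.
  have := mono_ok f _ heavyJ.
  have := g4 ([ffun x => f x], heavy m T Dg t0 J).
  rewrite /bad_mono heavyJ /= => /negP; rewrite -leNgt.
  have -> : medges [ffun x => f x] (heavy m T Dg t0 J) = medges f (heavy m T Dg t0 J).
    rewrite /mono_edges (_ : mono_pairs_off _ _ _ [ffun x => f x] _ =
      mono_pairs_off m T t0 f (heavy m T Dg t0 J)) //.
    by apply/setP => q; rewrite !inE !ffunE.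
  lra.
Qed.

Hypothesis y1 : y <= p * n%:R.
Hypothesis y2 : y <= eta ^+ 2 * (p * (n./2)%:R) / 4.
Hypothesis y3 : y <= p * (n * (t * m))%:R.
Hypothesis y4 : forall (f : V -> 'I_r) (U : {set V}), #|U|%:R <= delta * n%:R ->
  n%:R * (2 * r%:R) + y <= p * #|medges f U|%:R / 16.
Hypothesis y5 : y <= L / 4.

Lemma bad_degree_small x : EP (fun J => (bad_degree x J)%:R) <= expR (- y).
Proof.
case/andP: p01 => p0 _.
apply: le_trans (rs_upper_tail_const p01 (s := n%:R) _ _ (lexx _)) _.
- by apply: star_sub_pairs; rewrite !inE eqxx.
- by rewrite card_star ler_nat -[leqRHS]card_ord max_card.
- by rewrite ler_expR; have := y1; lra.
Qed.

Lemma bad_cross_small x : EP (fun J => (bad_cross x J)%:R) <= expR (- y).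
Proof.
case/andP: p01 => p0 _.
apply: le_trans (rs_lower_tail p01 (star_sub_pairs (opposite_notin x)) eta0) _.
rewrite ler_expR lerN2; apply: le_trans y2 _.
rewrite ler_wpM2r ?invr_ge0 // ler_wpM2l ?sqr_ge0 // ler_wpM2l // ler_nat.
by rewrite card_star card_opposite.
Qed.

Lemma bad_block_small : EP (fun J => (bad_block J)%:R) <= expR (- y).
Proof.
case/andP: p01 => p0 _.
apply: le_trans (rs_upper_tail_const p01 (s := (n * (t * m))%:R) _ _ (lexx _)) _.
- exact: block_edges_sub.
- rewrite ler_nat; apply: leq_trans (leq_imset_card _ _) _; exact: card_block_rel m0.
- by rewrite ler_expR; have := y3; lra.
Qed.

(** Relative deviation 1/2 gives the exponent [p * #|medges|%:R / 16]; the surplus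
    [n%:R * (2 * r%:R)] will pay for the choice of [fU]. *)
Lemma bad_mono_small fU :
  EP (fun J => (bad_mono fU J)%:R) <= expR (- (n%:R * (2 * r%:R) + y)).
Proof.
rewrite /bad_mono; have [Us|_] := boolP (#|fU.2|%:R <= delta * n%:R); last first.
  by apply: (rs_exp_false _ _ (b := fun=> false)); first exact: expR_ge0.
apply: le_trans (rs_lower_tail p01 (medges_sub fU.1 fU.2) (_ : 0 <= 1 / 2)) _; first by lra.
by rewrite ler_expR; have := y4 fU.1 Us; lra.
Qed.

(** The edges from [u] to the right half are independent of [bad_right J u], by
    [bad_right_resample], so the conditional upper tail applies. *)
Lemma bad_left_vertex_small u : EP (fun J => (bad_left_vertex u J)%:R) <= expR (- y).
Proof.
rewrite /bad_left_vertex; have [uA|_] := boolP (u \in lside); last first.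
  by apply: (rs_exp_false _ _ (b := fun=> false)); first exact: expR_ge0.
apply: le_trans (rs_upper_tail p01
  (W := fun J => star u (bad_right m T Dg t0 J u)) (S := star u (~: lside)) _ _ _ LE) _.
- by apply: star_sub_pairs; rewrite inE uA.
- by move=> J; apply: bad_right_star.
- by move=> e J eS; congr (star _ _); exact: bad_right_resample.
- by rewrite ler_expR lerN2.
Qed.

Lemma bad_right_vertex_small vi : EP (fun J => (bad_right_vertex vi J)%:R) <= expR (- y).
Proof.
rewrite /bad_right_vertex; have [vA|_] := boolP (vi.1 \notin lside); last first.
  by apply: (rs_exp_false _ _ (b := fun=> false)); first exact: expR_ge0.
apply: le_trans (rs_upper_tail p01
  (W := fun J => star vi.1 (bad_left m T Dg t0 J vi.1 vi.2))
  (S := star vi.1 [set u in lside | vclass m t0 u == vi.2]) _ _ _ LE) _.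
- by apply: star_sub_pairs; rewrite inE (negbTE vA).
- by move=> J; apply: bad_left_star.
- by move=> e J eS; congr (star _ _); exact: bad_left_resample.
- by rewrite ler_expR lerN2.
Qed.

Lemma bad_graph_small :
  EP (fun J => (bad_graph J)%:R) <= (t + 5)%:R * n%:R * expR (- y).
Proof.
have ey := expR_ge0 (- y).
have n1 : 1 <= n%:R :> R by rewrite ler1n.
(* There are [(2 * r) ^ n] pairs of a colouring and a set, and [2 * r%:R <= expR (2 * r%:R)]. *)
have mono : #|{: {ffun V -> 'I_r} * {set V}}|%:R * expR (- (n%:R * (2 * r%:R) + y))
    <= expR (- y).
  have -> : #|{: {ffun V -> 'I_r} * {set V}}| = ((2 * r) ^ n)%N.
    have card_set : #|{: {set V}}| = (2 ^ n)%N.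
      by rewrite -cardsT -powersetT card_powerset cardsT card_ord.
    by rewrite card_prod card_ffun card_set !card_ord expnMn mulnC.
  rewrite opprD expRD mulrA ler_piMl // expRN.
  rewrite ler_pdivrMr ?expR_gt0 // mul1r expRM_natl natrX lerXn2r ?nnegrE ?expR_ge0 //.
  by apply: le_trans (expR_ge1Dx _); rewrite natrM; lra.
apply: le_trans (rs_exp_or p01 (rs_exp_exists p01 bad_degree_small)
  (rs_exp_or p01 (rs_exp_exists p01 bad_cross_small)
  (rs_exp_or p01 bad_block_small
  (rs_exp_or p01 (rs_exp_exists p01 bad_mono_small)
  (rs_exp_or p01 (rs_exp_exists p01 bad_left_vertex_small)
     (rs_exp_exists p01 bad_right_vertex_small)))))) _.
have -> : #|{: V * 'I_t}| = (n * t)%N by rewrite card_prod !card_ord.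
rewrite !card_ord natrM natrD.
have : expR (- y) <= n%:R * expR (- y) by rewrite ler_peMl.
move: mono; lra.
Qed.

End FixedSize.

(** * Choice of the constants *)

Lemma pmulr_eq_gt0 (R : realType) (x y z : R) :
  0 < y -> x * y = z -> 0 < z -> 0 < x.
Proof. by move=> y0 <-; rewrite pmulr_lgt0. Qed.

(** The constants enter through product equations, which suit linear arithmetic. [kap'] fixes the
    degree loss [t%:R * L], [kap] the block size, [c'] makes [p * m%:R] large, [c] scales the number
    of deleted edges, and [sigma] the exponent of the failure probability. *)
Lemma gnp_prob_lower (R : realType) (gamma : R) (r t : nat) (T : rel 'I_t)
    (g kap' kap c c' sigma : R) (n : nat) (p s : R) :
  0 < gamma -> (0 < r)%N -> (0 < t)%N ->
  symmetric T -> (forall x y z, ~~ [&& T x y, T y z & T x z]) ->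
  (forall f : 'I_t -> 'I_r, exists x y, T x y /\ f x = f y) ->
  0 < g -> g <= 1 -> g <= gamma ->
  kap' * (32 * t%:R) = g ->
  kap * (128 * t%:R ^+ 3 * r%:R ^+ 2) = kap' ->
  c' * (512 * t%:R * r%:R ^+ 2 * (2 * r%:R + 1)) = kap ->
  c * (64 * t%:R * r%:R ^+ 2) = kap ->
  sigma * (64 * t%:R) = g ^+ 2 ->
  0 <= p <= 1 -> (4 <= n)%N -> 2 <= g * n%:R ->
  0 <= s -> s ^+ 2 = n%:R ->
  1 <= c' * (p * s) -> p <= c' ->
  1 - (t + 5)%:R * n%:R * expR (- (sigma * s)) <=
  gnp_prob p (fun Gamma : sgraph 'I_n =>
        [exists H : sgraph 'I_n,
          [&& spanning_subgraph H Gamma,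
              triangle_free H,
              (1 / 2 - gamma) * p * n%:R <= (min_degree H)%:R &
              [forall D : {set {set 'I_n}},
                (D \subset edges H) && (#|D|%:R < c * p^-1 * n%:R) ==>
                ~~ partite r (del_edges H D)]]]).
Proof.
move=> gamma0 r0 t0 T_sym T_triangle_free T_not_colorable.
move=> g0 g1 g_gamma.
set tR : R := t%:R; set rR : R := r%:R.
move=> kap'E kapE c'E cE sigmaE p01 n4 gn s0 s2 ps pc'.
have t1 : 1 <= tR by rewrite ler1n.
have r1 : 1 <= rR by rewrite ler1n.
have n4R : 4 <= n%:R :> R by rewrite ler_nat.
have tp : 0 < tR by rewrite ltr0n.
have rp : 0 < rR by rewrite ltr0n.
have rp1 : 0 < 2 * rR + 1 by rewrite addr_gt0 // mulr_gt0.
have t3 : 1 <= tR ^+ 3 by apply: exprn_ege1.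
have r2 : 1 <= rR ^+ 2 by apply: exprn_ege1.
have t3r2 : 1 <= tR ^+ 3 * rR ^+ 2 by rewrite mulr_ege1.
have tr2 : 1 <= tR * rR ^+ 2 by rewrite mulr_ege1.
have r3 : 1 <= 2 * rR + 1 by clear -rp; lra.
have tr3 : 1 <= tR * rR ^+ 2 * (2 * rR + 1) by rewrite mulr_ege1.
have kap'0 : 0 < kap' by apply: pmulr_eq_gt0 kap'E g0; clear -tp; lra.
have kap0 : 0 < kap by apply: pmulr_eq_gt0 kapE kap'0; clear -t3r2; lra.
have c'0 : 0 < c' by apply: pmulr_eq_gt0 c'E kap0; clear -tr3; lra.
have c0 : 0 < c by apply: pmulr_eq_gt0 cE kap0; clear -tr2; lra.
have sigma0 : 0 < sigma.
  by apply: pmulr_eq_gt0 sigmaE _; [clear -tp; lra | rewrite exprn_gt0].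
have kap'1 : kap' <= 1.
  have : kap' * 1 <= kap' * tR by rewrite ler_pM2l.
  clear -kap'E g1 kap'0; lra.
have kap1 : kap <= 1.
  have : kap * 1 <= kap * (tR ^+ 3 * rR ^+ 2) by rewrite ler_pM2l.
  clear -kapE kap'1 kap0; lra.
have c'kap : c' * 512 <= kap.
  have : c' * 1 <= c' * (tR * rR ^+ 2 * (2 * rR + 1)) by rewrite ler_pM2l.
  clear -c'E; lra.
have c'1 : c' <= 1 by clear -c'kap kap1 c'0; lra.
have p0' : 0 <= p by case/andP: p01.
have p1 : p <= 1 by case/andP: p01.
have p0 : 0 < p.
  rewrite lt_neqAle eq_sym p0' andbT.
  apply/eqP => p_eq0; move: ps; rewrite p_eq0 mul0r mulr0.
  by rewrite leNgt ltr01.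
have ps1 : 1 <= p * s.
  by apply: le_trans ps _; rewrite ler_piMl // mulr_ge0.
have s1 : 1 <= s by apply: le_trans ps1 _; rewrite ler_piMl.
have sn : s <= n%:R by rewrite -s2 expr2 ler_peMl.
have g2 : g ^+ 2 <= g by rewrite expr2 ler_piMl // ltW.
have sigma_g : 64 * sigma <= g ^+ 2.
  have : sigma * 1 <= sigma * tR by rewrite ler_pM2l.
  clear -sigmaE; lra.
have sigma1 : sigma <= 1 by clear -sigma_g g2 g1 sigma0; lra.
have pn : s <= p * n%:R by rewrite -s2 expr2 mulrA ler_peMl.
pose m := Num.truncn (kap / p ^+ 2).
have p2 : 0 < p ^+ 2 by rewrite exprn_gt0.
have p2c' : p ^+ 2 <= c'.
  by apply: le_trans pc'; rewrite expr2 ler_piMl.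
pose M : R := m%:R.
have /Num.Theory.truncn_itv/andP[Mle Mlt] : 0 <= kap / p ^+ 2 by rewrite divr_ge0 // ltW.
rewrite -/m ler_pdivlMr // -/M in Mle.
rewrite -/m ltr_pdivrMr // -natr1 -/M in Mlt.
(* Rounding down costs less than [p ^+ 2], which is at most [kap / 512]. *)
have Mge : kap <= 2 * (M * p ^+ 2) by clear -Mlt p2c' c'kap kap0; lra.
have m0 : (0 < m)%N.
  by rewrite lt0n; apply/eqP => m_eq0; move: Mge; rewrite /M m_eq0 mul0r mulr0 leNgt kap0.
have M0 : 0 < M by rewrite ltr0n.
have pM : 256 * (tR * rR ^+ 2 * (2 * rR + 1)) <= p * M.
  have : c' * (512 * tR * rR ^+ 2 * (2 * rR + 1)) <= c' * (2 * (p * M)).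
    rewrite c'E; apply: le_trans Mge _.
    have : p * (p * M) <= c' * (p * M) by rewrite ler_wpM2r // mulr_ge0 // ltW.
    clear; lra.
  rewrite ler_pM2l //; clear; lra.
(* The lower bound on [p] enters here: its square gives [1 <= c' ^+ 2 * p ^+ 2 * n%:R], so the
   blocks are short compared with [n]. *)
have Mn : M <= c' * n%:R.
  have ps2 : 1 <= (c' * (p * s)) ^+ 2 by apply: exprn_ege1.
  apply: le_trans (_ : M * (c' * (p * s)) ^+ 2 <= _); first by rewrite ler_peMr // ltW.
  have -> : M * (c' * (p * s)) ^+ 2 = (c' * n%:R) * (c' * (M * p ^+ 2)).
    by rewrite -s2; clear; ring.
  have Mp1 : M * p ^+ 2 <= 1 by apply: le_trans kap1.
  have h : c' * (M * p ^+ 2) <= 1.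
    apply: le_trans (_ : c' * 1 <= _); last by rewrite mulr1.
    by rewrite ler_pM2l.
  by rewrite ler_piMr // mulr_ge0 // ltW.
have tMn : 8 * (tR * M) <= n%:R.
  have tc' : tR * c' * 512 <= 1.
    have : (tR * c') * 1 <= (tR * c') * (rR ^+ 2 * (2 * rR + 1)).
      by rewrite ler_pM2l ?mulr_gt0 // mulr_ege1.
    clear -c'E kap1; lra.
  have : tR * M <= tR * (c' * n%:R) by rewrite ler_pM2l.
  have : (tR * c' * 512) * n%:R <= 1 * n%:R by rewrite ler_wpM2r.
  have : 0 <= tR * M by rewrite mulr_ge0 // ltW.
  clear; lra.
have tmn : (8 * (t * m) <= n)%N by rewrite -(ler_nat R) !natrM.
(* At most one block of the left half is incomplete, so the complete ones cover at least a quarter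
   of all vertices. *)
have Nn : (n <= 4 * (n./2 %/ (t * m) * (t * m)))%N.
  have tm0 : (0 < t * m)%N by rewrite muln_gt0 t0.
  have := divn_eq n./2 (t * m); have := ltn_pmod n./2 tm0.
  move: tmn n4; rewrite -divn2; clear; lia.
have NnR : n%:R <= 4 * ((n./2 %/ (t * m))%:R * (tR * M)) by rewrite -!natrM ler_nat.
(* With this value the pairs touching [U] cost at most half of the count of monochromatic pairs; see
   [h4] below. *)
pose delta : R := (16 * tR ^+ 2 * rR ^+ 2)^-1.
have delta_gt0 : 0 < 16 * tR ^+ 2 * rR ^+ 2 by rewrite !mulr_gt0 // exprn_gt0.
have deltaE : delta * (16 * tR ^+ 2 * rR ^+ 2) = 1 by rewrite mulVf // gt_eqF.
have delta0 : 0 < delta by rewrite invr_gt0.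
have edges_many (f : 'I_n -> 'I_r) (U : {set 'I_n}) : #|U|%:R <= delta * n%:R ->
    n%:R * M <= 16 * (tR * rR ^+ 2) * #|mono_edges m T t0 f U|%:R.
  move=> Us.
  have := card_mono_edges t0 m0 T_not_colorable r0 T_sym f U.
  set N := (n./2 %/ (t * m))%N in NnR *; set E := #|mono_edges _ _ _ _ _|.
  rewrite -(ler_nat R) !(natrM, natrD) -/M -/tR -/rR => h.
  have h1 : n%:R * M <= 4 * (N%:R * (tR * M)) * M by rewrite ler_pM2r.
  have h2 : 4 * tR * (N%:R * (M * M)) <=
            4 * tR * (rR * rR * (2 * (E%:R + #|U|%:R * (tR * M)))).
    by rewrite ler_pM2l // mulr_gt0.
  have h3 : 8 * (tR ^+ 2 * rR ^+ 2 * M) * #|U|%:R <=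
            8 * (tR ^+ 2 * rR ^+ 2 * M) * (delta * n%:R).
    by rewrite ler_wpM2l // !mulr_ge0 // ?exprn_ge0 // ltW.
  have h4 : 8 * (tR ^+ 2 * rR ^+ 2 * M) * (delta * n%:R) =
            (delta * (16 * tR ^+ 2 * rR ^+ 2)) * (n%:R * M) / 2 by clear; field.
  rewrite h4 deltaE in h3.
  clear -h1 h2 h3; lra.
have half1 : n%:R - 1 <= 2 * (n./2)%:R :> R.
  have : (n <= 2 * n./2 + 1)%N by rewrite -divn2; clear; lia.
  by rewrite -(ler_nat R) natrD natrM; clear; lra.
(* [Dg] makes [DgE] an equality, and [L] makes the total degree loss [tR * L] equal to
   [g / 2 * (p * n%:R)]. *)
pose Dg := 128 * tR ^+ 3 * rR ^+ 2 * (p * M).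
pose L := 16 * kap' * (p * n%:R).
have pn0 : 0 < p * n%:R by apply: lt_le_trans pn; apply: lt_le_trans s1.
have Dg0 : 0 < Dg by rewrite !mulr_gt0 // exprn_gt0.
have DgE : 8 * p * (n * (t * m))%:R <= delta * n%:R * Dg.
  rewrite !natrM -/M /Dg.
  have -> : delta * n%:R * (128 * tR ^+ 3 * rR ^+ 2 * (p * M)) =
    (delta * (16 * tR ^+ 2 * rR ^+ 2)) * (8 * p * (n%:R * (tR * M))) by clear; ring.
  by rewrite deltaE mul1r.
have L0 : 0 <= L by rewrite !mulr_ge0 // ltW.
have LE : 4 * p * (Dg * (4 * p * n%:R)) <= L.
  have -> : 4 * p * (Dg * (4 * p * n%:R)) =
    (16 * (p * n%:R)) * ((M * p ^+ 2) * (128 * tR ^+ 3 * rR ^+ 2)).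
    by rewrite /Dg; clear; ring.
  have -> : L = (16 * (p * n%:R)) * (kap * (128 * tR ^+ 3 * rR ^+ 2)).
    by rewrite kapE /L; clear; ring.
  rewrite ler_wpM2l ?mulr_ge0 //.
  by rewrite ler_wpM2r // !mulr_ge0 // exprn_ge0 // ltW.
have sigma_s : sigma * s <= s by rewrite ler_piMl.
have y1 : sigma * s <= p * n%:R by apply: le_trans pn.
have y2 : sigma * s <= (g / 2) ^+ 2 * (p * (n./2)%:R) / 4.
  have g20 : 0 <= g ^+ 2 by rewrite exprn_ge0 // ltW.
  have h1 : g ^+ 2 * s <= g ^+ 2 * (p * n%:R) by rewrite ler_wpM2l.
  have h2 : p * n%:R <= p * (4 * (n./2)%:R).
    by rewrite ler_pM2l //; clear -half1 n4R; lra.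
  have h3 : g ^+ 2 * (p * n%:R) <= g ^+ 2 * (p * (4 * (n./2)%:R)) by rewrite ler_wpM2l.
  have h4 : (64 * sigma) * s <= g ^+ 2 * s by rewrite ler_wpM2r.
  clear -h1 h3 h4; lra.
have y3 : sigma * s <= p * (n * (t * m))%:R.
  rewrite !natrM -/M.
  have -> : p * (n%:R * (tR * M)) = n%:R * (tR * (p * M)) by clear; ring.
  apply: le_trans sigma_s _; apply: le_trans sn _.
  by rewrite ler_peMr // mulr_ege1 //; clear -pM tr3; lra.
have y4 (f : 'I_n -> 'I_r) (U : {set 'I_n}) : #|U|%:R <= delta * n%:R ->
    n%:R * (2 * rR) + sigma * s <= p * #|mono_edges m T t0 f U|%:R / 16.
  move=> /(edges_many f); set E : R := #|_|%:R => nM.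
  have h1 : p * (n%:R * M) <= p * (16 * (tR * rR ^+ 2) * E) by rewrite ler_pM2l.
  have h2 : n%:R * (256 * (tR * rR ^+ 2 * (2 * rR + 1))) <= n%:R * (p * M).
    by rewrite ler_wpM2l.
  (* Of the exponent [n%:R * (2 * rR + 1)], the part [n%:R * (2 * rR)] is for the union bound, and
     the remaining [n%:R] dominates [sigma * s]. *)
  have : (tR * rR ^+ 2) * (16 * (n%:R * (2 * rR + 1))) <= (tR * rR ^+ 2) * (p * E).
    clear -h1 h2; lra.
  rewrite ler_pM2l; last by apply: lt_le_trans tr2.
  clear -sigma_s sn; lra.
have y5 : sigma * s <= L / 4.
  have h1 : kap' * s <= kap' * (p * n%:R) by rewrite ler_pM2l.
  have h2 : sigma * (64 * tR) <= kap' * (64 * tR).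
    rewrite sigmaE; clear -kap'E g2 g0; lra.
  rewrite ler_pM2r ?mulr_gt0 // in h2.
  have h3 : sigma * s <= kap' * s by rewrite ler_wpM2r.
  have h4 : 0 <= kap' * s by rewrite mulr_ge0 // ltW.
  rewrite /L; clear -h1 h3 h4; lra.
have n0 : (0 < n)%N by apply: leq_trans n4.
have eta0 : 0 <= g / 2 by clear -g0; lra.
have eta1 : g / 2 <= 1 by clear -g1; lra.
(* Of the slack [g], a quarter goes to the Chernoff deviation and a half to deleted edges; the last
   quarter absorbs the rounding of [n./2], by [2 <= g * n%:R]. *)
have deg_ok : (1 / 2 - gamma) * p * n%:R <=
    (1 - g / 2) * (p * (n./2)%:R) - tR * L.
  have h1 : (1 / 2 - gamma) * (p * n%:R) <= (1 / 2 - g) * (p * n%:R).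
    by rewrite ler_pM2r //; clear -g_gamma; lra.
  have tL : tR * L = g / 2 * (p * n%:R).
    by rewrite -kap'E /L; clear; field.
  have h2 : (1 - g / 2) * p * (n%:R - 1) <= (1 - g / 2) * p * (2 * (n./2)%:R).
    by rewrite ler_wpM2l // mulr_ge0 // subr_ge0.
  have h3 : p * 2 <= p * (g * n%:R) by rewrite ler_pM2l.
  have h4 : 0 <= p * g by rewrite mulr_ge0 // ltW.
  rewrite tL; clear -h1 h2 h3 h4; lra.
have mono_ok (f : 'I_n -> 'I_r) (U : {set 'I_n}) : #|U|%:R <= delta * n%:R ->
    c * p^-1 * n%:R <= p * #|mono_edges m T t0 f U|%:R / 2.
  move=> /(edges_many f); set E : R := #|_|%:R => nM.
  have h1 : p * (n%:R * M) <= p * (16 * (tR * rR ^+ 2) * E) by rewrite ler_pM2l.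
  have h2 : kap * p^-1 <= 2 * (M * p).
    rewrite ler_pdivrMr //; move: Mge; clear; lra.
  have h3 : kap * p^-1 * n%:R <= 2 * (M * p) * n%:R by rewrite ler_wpM2r.
  rewrite -cE in h3.
  have : (tR * rR ^+ 2) * (c * p^-1 * n%:R) <= (tR * rR ^+ 2) * (p * E / 2).
    set q := p^-1 in h3 *; clear -h1 h3; lra.
  by rewrite ler_pM2l //; apply: lt_le_trans tr2.
have ell_le : (1 - g / 2) * (p * (n./2)%:R) <= (1 - g / 2) * (p * (n./2)%:R) by [].
apply: le_trans (gnp_prob_ge_exp p01 (fun G => good_graph p01 n0 m0 T_sym
   T_triangle_free Dg0 L0 eta0 DgE LE ell_le eta1 (G := G) deg_ok (ltW gamma0) mono_ok)).
rewrite lerD2l lerN2.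
exact: (bad_graph_small p01 n0 m0 T_triangle_free Dg0 L0 eta0 DgE LE ell_le eta1).
Qed.

(** The fourth power of [y / 4 <= expR (y / 4)]. With [y] of order [sqrt n] it makes
    [n * expR (- y)] of order [1 / n]. *)
Lemma expRN_le_pow4 (R : realType) (y : R) : 0 < y -> expR (- y) <= 256 / y ^+ 4.
Proof.
move=> y0; have y40 : 0 < y ^+ 4 by rewrite exprn_gt0.
rewrite ler_pdivlMr // expRN mulrC ler_pdivrMr ?expR_gt0 //.
have -> : expR y = expR (y / 4) ^+ 4 by rewrite -expRM_natl; congr expR; lra.
have h : (y / 4) ^+ 4 <= expR (y / 4) ^+ 4.
  rewrite lerXn2r ?nnegrE ?expR_ge0 //; first by lra.
  by apply: le_trans (expR_ge1Dx _); lra.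
have -> : y ^+ 4 = 256 * (y / 4) ^+ 4 by field.
have p256 : 0 < 256 :> R by clear; lra.
by rewrite (ler_pM2l p256).
Qed.

(** * Passage to the limit *)

Local Open Scope classical_set_scope.
Local Open Scope ring_scope.

Theorem theorem5 (R : realType) (gamma : R) (hgamma : 0 < gamma)
    (r : nat) (hr : (0 < r)%N) :
  exists c c' : R, [/\ 0 < c, 0 < c' &
    forall p : nat -> R,
      (forall n, 0 <= p n <= 1) ->
      (\forall n \near \oo, n%:R `^ (- (1 / 2)) / c' <= p n <= c') ->
      gnp_prob (p n) (fun Gamma : sgraph 'I_n =>
        [exists H : sgraph 'I_n,
          [&& spanning_subgraph H Gamma,
              triangle_free H,
              (1 / 2 - gamma) * p n * n%:R <= (min_degree H)%:R &
              [forall D : {set {set 'I_n}},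
                (D \subset edges H) && (#|D|%:R < c * (p n)^-1 * n%:R) ==>
                ~~ partite r (del_edges H D)]]])
        @[n --> \oo] --> (1 : R)].
Proof.
have [t [T [t0 T_sym T_tri T_col]]] := template_exists r.
have tp : 0 < t%:R :> R by rewrite ltr0n.
have rp : 0 < r%:R :> R by rewrite ltr0n.
(* A smaller [gamma] is a stronger claim, so it may be capped at 1, which keeps [1 - g / 2]
   positive. *)
pose g : R := Num.min gamma 1.
have g0 : 0 < g by rewrite lt_min hgamma ltr01.
have g1 : g <= 1 by rewrite ge_min lexx orbT.
have ggamma : g <= gamma by rewrite ge_min lexx.
pose y1 : R := 32 * t%:R; have y1p : 0 < y1 by rewrite mulr_gt0.
pose y2 : R := 128 * t%:R ^+ 3 * r%:R ^+ 2.
have y2p : 0 < y2 by rewrite !mulr_gt0 // exprn_gt0.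
pose y3 : R := 512 * t%:R * r%:R ^+ 2 * (2 * r%:R + 1).
have y3p : 0 < y3.
  have : 0 < t%:R * r%:R ^+ 2 * (2 * r%:R + 1) :> R.
    by rewrite mulr_gt0 ?addr_gt0 ?mulr_gt0 ?exprn_gt0.
  rewrite /y3; lra.
pose y4 : R := 64 * t%:R * r%:R ^+ 2.
have y4p : 0 < y4 by rewrite !mulr_gt0 // exprn_gt0.
pose y5 : R := 64 * t%:R; have y5p : 0 < y5 by rewrite mulr_gt0.
pose kap' := g / y1; pose kap := kap' / y2.
have kap0 : 0 < kap by rewrite !divr_gt0.
pose c' := kap / y3; pose c := kap / y4; pose sigma := g ^+ 2 / y5.
have c'0 : 0 < c' by rewrite divr_gt0.
have sigma0 : 0 < sigma by rewrite divr_gt0 // exprn_gt0.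
exists c, c'; split=> [||p p01 pbounds]; [by rewrite divr_gt0 | by [] |].
(* The failure probability is at most [A / n]; the factor 2 in [K] accounts for [harmonic n] being
   [1 / (n + 1)]. *)
pose A : R := (t + 5)%:R * (256 / sigma ^+ 4); pose K : R := A * 2.
have A0 : 0 <= A.
  have B0 : 0 <= 256 / sigma ^+ 4.
    by apply: divr_ge0; [lra | rewrite exprn_ge0 // ltW].
  exact: mulr_ge0 (ler0n _ _) B0.
have lim1 : (1 - K * harmonic n) @[n --> \oo] --> (1 : R).
  rewrite -[X in _ --> X]subr0 -(mulr0 K).
  by apply: cvgB; [exact: cvg_cst | apply: cvgMr; exact: cvg_harmonic].
apply: (squeeze_cvgr (h := fun=> 1) _ lim1); last exact: cvg_cst.
near=> n.
rewrite gnp_prob_le1 // andbT.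
have n4 : (4 <= n)%N by near: n; exact: nbhs_infty_ge.
have gn : 2 <= g * n%:R.
  rewrite mulrC -ler_pdivrMr //; near: n; exact: nbhs_infty_ger.
have /andP[plow pc'] : n%:R `^ (- (1 / 2)) / c' <= p n <= c' by near: n.
have np : 0 < n%:R :> R by rewrite ltr0n; apply: leq_trans n4.
pose s := Num.sqrt (n%:R : R).
have s0 : 0 < s by rewrite sqrtr_gt0.
have s2 : s ^+ 2 = n%:R by rewrite sqr_sqrtr ?ler0n.
have ps : 1 <= c' * (p n * s).
  move: plow; rewrite div1r powRN powR12_sqrt ?ler0n // -/s.
  by rewrite ler_pdivrMr // -[leLHS]mul1r ler_pdivrMr // mulrAC mulrC.
have lower := @gnp_prob_lower R gamma r t T g kap' kap c c' sigma n (p n) s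
  hgamma hr t0 T_sym T_tri T_col g0 g1 ggamma
  (divfK (lt0r_neq0 y1p) _) (divfK (lt0r_neq0 y2p) _) (divfK (lt0r_neq0 y3p) _)
  (divfK (lt0r_neq0 y4p) _) (divfK (lt0r_neq0 y5p) _)
  (p01 n) n4 gn (ltW s0) s2 ps pc'.
apply: le_trans lower; rewrite lerD2l lerN2.
have := expRN_le_pow4 (mulr_gt0 sigma0 s0).
rewrite exprMn (_ : s ^+ 4 = n%:R ^+ 2); last by rewrite -s2 -exprM.
move=> e4.
apply: (@le_trans _ _ ((t + 5)%:R * n%:R * (256 / (sigma ^+ 4 * n%:R ^+ 2)))).
  by rewrite ler_wpM2l // mulr_ge0.
have -> : (t + 5)%:R * n%:R * (256 / (sigma ^+ 4 * n%:R ^+ 2)) =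
    A * n%:R^-1.
  by rewrite /A; field; rewrite !gt_eqF.
rewrite /K -[leRHS]mulrA; apply: ler_wpM2l A0 _ _ _.
rewrite /harmonic /= ler_pdivlMr ?ltr0Sn // mulrC ler_pdivrMr // -natrM ler_nat.
by move: n4; clear; lia.
Unshelve. all: by end_near.
Qed.
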